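(* Every filtered dg-algebra has a filtered minimal $A_\infty$-model.
   Context: Work over a field. A filtered dg-algebra $(A,d,\mu,F)$ is a dg-algebra with a decreasing, bounded below, exhaustive filtration $F$ with $d(F^pA^n)\subseteq F^pA^{n+1}$ and $\mu(F^pA\otimes F^qA)\subseteq F^{p+q}A$. A filtered $A_\infty$-algebra is an $A_\infty$-algebra $(M,d,\nu_s)$ with such a filtration satisfying $d(F^pM^n)\subseteq F^pM^{n+1}$ and $\nu_s(F^{p_1}M^{n_1}\otimes\cdots\otimes F^{p_s}M^{n_s})\subseteq F^{p_1+\cdots+p_s}M^{n_1+\cdots+n_s-s+2}$; it is filtered minimal if $M$ has a bigrading with $F^pM^n=\bigoplus_{q\geq p}M^{q,n-q}$ and $d(F^pM^n)\subseteq F^{p+1}M^{n+1}$. A filtered $A_\infty$-morphism $f=(f_s)$ is an $A_\infty$-morphism with $f_s(F^{p_1}\otimes\cdots\otimes F^{p_s})\subseteq F^{p_1+\cdots+p_s}$, and it is a filtered quasi-isomorphism if $F^pf_1$ is a quasi-isomorphism for every $p$. A filtered minimal $A_\infty$-model of a filtered dg-algebra $A$ (viewed as an $A_\infty$-algebra with $\nu_2=\mu$, $\nu_s=0$ for $s\ge3$) is a filtered minimal $A_\infty$-algebra $M$ together with a filtered $A_\infty$-morphism $M\to A$ which is a filtered quasi-isomorphism. *)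

(* Defs.v *)
(* Filtered dg-algebras, filtered A-infinity algebras,
   filtered A-infinity morphisms and filtered minimal models over a field K.
   A Z-graded K-vector space is a K-vector space V together with a family of
   subspaces D n (the homogeneous elements of degree n) forming a direct-sum
   decomposition V = (+)_n D n.  Multilinear maps out of tensor powers are
   represented (as usual over a field) by maps on lists of elements that are
   linear in every argument; all identities are imposed on homogeneous
   elements, with Koszul signs. *)
From HB Require Import structures.
From mathcomp Require Import all_boot all_order all_algebra.
Set Implicit Arguments. Unset Strict Implicit. Unset Printing Implicit Defensive.
Import Order.TTheory GRing.Theory Num.Theory.
Local Open Scope ring_scope.

Section Defs.
Variable K : fieldType.

Definition sgn (k : int) : K := (-1) ^+ (odd (absz k)).

Section OneSpace.
Variable V : lmodType K.

Definition subspace (S : V -> Prop) : Prop :=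
  S 0 /\ forall (a : K) (x y : V), S x -> S y -> S (a *: x + y).

Definition lin_fun (W : lmodType K) (g : V -> W) : Prop :=
  forall (a : K) (x y : V), g (a *: x + y) = a *: g x + g y.

Definition bilin (g : V -> V -> V) : Prop :=
  (forall y, lin_fun (fun x => g x y)) /\ (forall x, lin_fun (g x)).

Definition multilin (W : lmodType K) (s : nat) (g : seq V -> W) : Prop :=
  forall (xs : seq V) (i : nat) (a : K) (x y : V), size xs = s -> (i < s)%N ->
    g (set_nth 0 xs i (a *: x + y)) =
    a *: g (set_nth 0 xs i x) + g (set_nth 0 xs i y).

Definition indep (S : int -> V -> Prop) : Prop :=
  forall s : seq (int * V), uniq (map fst s) ->
    (forall z, z \in s -> S z.1 z.2) -> \sum_(z <- s) z.2 = 0 ->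
    forall z, z \in s -> z.2 = 0.

Definition spanned (S : int -> V -> Prop) (P : int -> bool) (v : V) : Prop :=
  exists s : seq (int * V),
    (forall z, z \in s -> P z.1 /\ S z.1 z.2) /\ v = \sum_(z <- s) z.2.

Definition is_grading (D : int -> V -> Prop) : Prop :=
  (forall n, subspace (D n)) /\ indep D /\ (forall v, spanned D (fun _ => true) v).

Definition is_filtration (D : int -> V -> Prop) (F : int -> int -> V -> Prop) :=
  (forall p n, subspace (F p n)) /\
  (forall p n v, F p n v -> D n v) /\
  (forall p n v, F (p + 1) n v -> F p n v) /\
  (forall n v, D n v -> exists p, F p n v) /\
  (forall n, exists p, forall v, F p n v -> v = 0).

Definition homog (D : int -> V -> Prop) (n : nat) (ns : seq int) (xs : seq V) :=
  size ns = n /\ size xs = n /\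
  forall i, (i < n)%N -> D (nth 0 ns i) (nth 0 xs i).

Definition filt_homog (F : int -> int -> V -> Prop) (n : nat)
    (ps ns : seq int) (xs : seq V) :=
  size ps = n /\ size ns = n /\ size xs = n /\
  forall i, (i < n)%N -> F (nth 0 ps i) (nth 0 ns i) (nth 0 xs i).

End OneSpace.

Definition isum (ns : seq int) : int := \sum_(x <- ns) x.
Definition dsum (ns : seq int) (p : nat) : int := isum (take p ns).
(* starting position of the j-th block of a composition cs *)
Definition psum (cs : seq nat) (j : nat) : nat := sumn (take j cs).

(* Stasheff relations, with Koszul sign rule:
   sum_{r+s+t=n, s>=1} (-1)^{r+st} m_{r+1+t} (1^r (x) m_s (x) 1^t) = 0 *)
Definition ainf_rel (V : lmodType K) (D : int -> V -> Prop)
    (m : nat -> seq V -> V) : Prop :=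
  forall (n : nat) (ns : seq int) (xs : seq V), (0 < n)%N -> homog D n ns xs ->
    \sum_(r < n.+1) \sum_(s < n.+1 | (0 < s)%N && (r + s <= n)%N)
      sgn ((r + s * (n - r - s))%N%:Z + (s%:Z * dsum ns r)) *:
        m (r + 1 + (n - r - s))%N
          (take r xs ++ m (nat_of_ord s) (take s (drop r xs)) :: drop (r + s) xs)
    = 0.

Definition ainf_ops (V : lmodType K) (d : V -> V) (nu : nat -> seq V -> V)
  (s : nat) (xs : seq V) : V := if s == 1%N then d (nth 0 xs 0) else nu s xs.

Definition dga_ops (V : lmodType K) (d : V -> V) (mu : V -> V -> V)
  (s : nat) (xs : seq V) : V :=
  match s with
  | 1 => d (nth 0 xs 0)
  | 2 => mu (nth 0 xs 0) (nth 0 xs 1)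
  | _ => 0
  end.

(* signs for the A-infinity morphism equation, for a composition
   cs = (i_1, ..., i_k) of n and degrees ns of the inputs *)
Definition usign (cs : seq nat) : nat :=
  (\sum_(j < size cs) (size cs - 1 - j) * (nth 0 cs j - 1))%N.
Definition esign (cs : seq nat) (ns : seq int) : int :=
  \sum_(j < size cs) (1 - (nth 0 cs j)%:Z) * dsum ns (psum cs j).
Definition fblocks (W V : lmodType K) (f : nat -> seq W -> V)
    (cs : seq nat) (xs : seq W) : seq V :=
  [seq f (nth 0 cs j) (take (nth 0 cs j) (drop (psum cs j) xs))
  | j <- iota 0 (size cs)].

(* A-infinity morphism equation:
   sum_{r+s+t=n} (-1)^{r+st} f_{r+1+t}(1^r (x) m_s (x) 1^t)
   = sum_{i_1+..+i_k=n} (-1)^{sum_j (k-j)(i_j-1)} m'_k (f_{i_1} (x) .. (x) f_{i_k}) *)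
Definition ainf_morph_rel (W V : lmodType K) (DW : int -> W -> Prop)
    (mW : nat -> seq W -> W) (mV : nat -> seq V -> V) (f : nat -> seq W -> V) :=
  forall (n : nat) (ns : seq int) (xs : seq W), (0 < n)%N -> homog DW n ns xs ->
    \sum_(r < n.+1) \sum_(s < n.+1 | (0 < s)%N && (r + s <= n)%N)
      sgn ((r + s * (n - r - s))%N%:Z + (s%:Z * dsum ns r)) *:
        f (r + 1 + (n - r - s))%N
          (take r xs ++ mW (nat_of_ord s) (take s (drop r xs)) :: drop (r + s) xs)
    =
    \sum_(k < n.+1 | (0 < k)%N)
      \sum_(c : k.-tuple 'I_n.+1 |
              all (fun i => 0 < i)%N (map val c) && (sumn (map val c) == n))
        sgn ((usign (map val c))%:Z + esign (map val c) ns) *: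
          mV k (fblocks f (map val c) xs).

Definition filtered_dga (V : lmodType K) (D : int -> V -> Prop)
    (F : int -> int -> V -> Prop) (d : V -> V) (mu : V -> V -> V) : Prop :=
  is_grading D /\ is_filtration D F /\ lin_fun d /\ bilin mu /\
  (forall n v, D n v -> D (n + 1) (d v)) /\
  (forall n m x y, D n x -> D m y -> D (n + m) (mu x y)) /\
  (forall x, d (d x) = 0) /\
  (forall x y z, mu (mu x y) z = mu x (mu y z)) /\
  (forall n x y, D n x -> d (mu x y) = mu (d x) y + sgn n *: mu x (d y)) /\
  (forall p n v, F p n v -> F p (n + 1) (d v)) /\
  (forall p q n m x y, F p n x -> F q m y -> F (p + q) (n + m) (mu x y)).

Definition filtered_ainf (W : lmodType K) (D : int -> W -> Prop)
    (F : int -> int -> W -> Prop) (d : W -> W) (nu : nat -> seq W -> W) : Prop :=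
  is_grading D /\ is_filtration D F /\ lin_fun d /\
  (forall s, (2 <= s)%N -> multilin s (nu s)) /\
  (forall n v, D n v -> D (n + 1) (d v)) /\
  (forall s ns xs, (2 <= s)%N -> homog D s ns xs ->
     D (isum ns + 2 - s%:Z) (nu s xs)) /\
  (forall p n v, F p n v -> F p (n + 1) (d v)) /\
  (forall s ps ns xs, (2 <= s)%N -> filt_homog F s ps ns xs ->
     F (isum ps) (isum ns + 2 - s%:Z) (nu s xs)) /\
  ainf_rel D (ainf_ops d nu).

Definition filtered_minimal_ainf (W : lmodType K) (D : int -> W -> Prop)
    (F : int -> int -> W -> Prop) (d : W -> W) (nu : nat -> seq W -> W) : Prop :=
  filtered_ainf D F d nu /\
  exists B : int -> int -> W -> Prop,
    (forall q m, subspace (B q m)) /\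
    (forall n, indep (fun q => B q (n - q))) /\
    (forall p n v, F p n v <-> spanned (fun q => B q (n - q)) (fun q => p <= q) v) /\
    (forall p n v, F p n v -> F (p + 1) (n + 1) (d v)).

Definition filtered_ainf_morph (W V : lmodType K)
    (DW : int -> W -> Prop) (FW : int -> int -> W -> Prop) (mW : nat -> seq W -> W)
    (DV : int -> V -> Prop) (FV : int -> int -> V -> Prop) (mV : nat -> seq V -> V)
    (f : nat -> seq W -> V) : Prop :=
  (forall s, (1 <= s)%N -> multilin s (f s)) /\
  (forall s ns xs, (1 <= s)%N -> homog DW s ns xs ->
     DV (isum ns + 1 - s%:Z) (f s xs)) /\
  (forall s ps ns xs, (1 <= s)%N -> filt_homog FW s ps ns xs ->
     FV (isum ps) (isum ns + 1 - s%:Z) (f s xs)) /\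
  ainf_morph_rel DW mW mV f.

(* F^p f1 : (F^p W, dW) -> (F^p V, dV) is a quasi-isomorphism for every p,
   i.e. induces bijections H^n(F^p W) -> H^n(F^p V) for all n *)
Definition filtered_qiso (W V : lmodType K)
    (FW : int -> int -> W -> Prop) (dW : W -> W)
    (FV : int -> int -> V -> Prop) (dV : V -> V) (f1 : W -> V) : Prop :=
  forall p n : int,
    (forall a, FV p n a -> dV a = 0 ->
       exists x b, FW p n x /\ dW x = 0 /\ FV p (n - 1) b /\ a = f1 x + dV b) /\
    (forall x b, FW p n x -> dW x = 0 -> FV p (n - 1) b -> f1 x = dV b ->
       exists y, FW p (n - 1) y /\ x = dW y).

End Defs.

(* Main.v *)
(* Complements in F^p V^n adapted to the differential of F^p / F^(p+1) yield a
   filtration preserving homotopy h with h^2 = 0 and h d h = h, such that d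
   strictly raises the filtration on the image W of the projection
   harm = 1 - d h - h d.  Thus W is a filtered deformation retract of V with a
   minimal differential, and the product is transferred to it: put
     f_1 = inclusion,  f_n = - h lam_n,  nu_n = harm lam_n  (n >= 2),
     lam_n = sum_(i + j = n) +- mu (f_i (x) f_j).
   The single identity
     d lam_n + sum_(r + s + t = n) +- lam_(r+1+t) (1^r (x) nu_s (x) 1^t) = 0,
   which follows from associativity, the Leibniz rule and the morphism relations
   of lower arity, gives the morphism relation upon applying - h and the Stasheff
   relation upon applying harm. *)
Require Import Defs.
From HB Require Import structures.
From mathcomp Require Import all_boot all_order all_algebra.
From mathcomp Require Import boolp classical_sets.
From mathcomp Require Import zify ring.
Set Implicit Arguments. Unset Strict Implicit. Unset Printing Implicit Defensive.
Import Order.TTheory GRing.Theory Num.Theory.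
Local Open Scope ring_scope.

(** The filtration need not split compatibly with [d], so a homotopy chosen separately on each F^p /
    F^(p+1) satisfies the required identities only up to terms of higher filtration. The remedy is
    to extend to F^p the homotopy already given on F^(p+1): u + d c + e + c' goes to h u + c. This
    descending recursion can start because in each degree F^p vanishes for large p, and it reaches
    every homogeneous element because the filtration is exhaustive. The identities then hold
    exactly, which makes [harm] a true idempotent. A second obstacle is that the operations must be
    multilinear on all of [V], whereas Koszul signs make sense only for homogeneous elements; a
    linear sign involution [eps] reconciles the two. *)

Lemma uniq_map_inj (T U : eqType) (f : T -> U) (s : seq T) :
  uniq (map f s) -> {in s &, injective f}.
Proof.
elim: s => //= a s IH /andP[nfa us] x y.
rewrite !inE => /orP[/eqP->|xs] /orP[/eqP->|ys] // E.
- by case/negP: nfa; rewrite E map_f.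
- by case/negP: nfa; rewrite -E map_f.
- exact: IH.
Qed.

(** * Linear maps, subspaces and complements *)

Section LinFun.
Variables (K : fieldType) (V W : lmodType K) (g : V -> W).
Hypothesis gL : lin_fun g.

Lemma lin_funD x y : g (x + y) = g x + g y.
Proof. by have := gL 1 x y; rewrite !scale1r. Qed.

Lemma lin_fun0 : g 0 = 0.
Proof. by apply: (addrI (g 0)); rewrite -lin_funD !addr0. Qed.

Lemma lin_funZ a x : g (a *: x) = a *: g x.
Proof. by have := gL a x 0; rewrite lin_fun0 !addr0. Qed.

Lemma lin_funN x : g (- x) = - g x.
Proof. by rewrite -scaleN1r lin_funZ scaleN1r. Qed.

Lemma lin_funB x y : g (x - y) = g x - g y.
Proof. by rewrite lin_funD lin_funN. Qed.

Lemma lin_fun_sum I (r : seq I) (P : pred I) (E : I -> V) :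
  g (\sum_(i <- r | P i) E i) = \sum_(i <- r | P i) g (E i).
Proof.
apply: (big_ind2 (fun x y => g x = y)) => //; first exact: lin_fun0.
by move=> x1 x2 y1 y2 <- <-; exact: lin_funD.
Qed.

End LinFun.

Section Subspace.
Variables (K : fieldType) (V : lmodType K).
Implicit Types S T : V -> Prop.

Lemma subspace0 S : subspace S -> S 0. Proof. by case. Qed.

Lemma subspaceD S x y : subspace S -> S x -> S y -> S (x + y).
Proof. by case=> _ SL Sx Sy; rewrite -[x]scale1r; exact: SL. Qed.

Lemma subspaceZ S a x : subspace S -> S x -> S (a *: x).
Proof. by case=> S0 SL Sx; rewrite -[_ *: x]addr0; exact: SL. Qed.

Lemma subspaceN S x : subspace S -> S x -> S (- x).
Proof. by move=> SS Sx; rewrite -scaleN1r; exact: subspaceZ. Qed.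

Lemma subspaceB S x y : subspace S -> S x -> S y -> S (x - y).
Proof. by move=> SS Sx Sy; apply: subspaceD => //; exact: subspaceN. Qed.

Lemma subspace_sum S (I : eqType) (r : seq I) (P : pred I) (E : I -> V) :
  subspace S -> (forall i, i \in r -> P i -> S (E i)) ->
  S (\sum_(i <- r | P i) E i).
Proof.
move=> SS SE; rewrite big_seq_cond; apply: (big_ind S) => [|x y|i].
- exact: subspace0.
- exact: subspaceD.
- by case/andP; exact: SE.
Qed.

(** Zorn's lemma, applied to the subspaces of [T] that meet [S] only in 0. *)
Lemma subspace_complement S T : subspace S -> subspace T ->
  exists C : V -> Prop, [/\ subspace C, forall x, C x -> T x,
    forall x, C x -> S x -> x = 0 &
    forall x, T x -> exists s c, [/\ S s, C c & x = s + c]].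
Proof.
move=> SS ST.
(* [P] does not ask for 0, so that the empty set, which is the union of the empty chain, satisfies
   it. Maximality restores 0 below: an [A] without 0 is empty, hence strictly smaller than {0}. *)
pose P (A : set V) := [/\ forall x, A x -> T x,
  forall a x y, A x -> A y -> A (a *: x + y) & forall x, A x -> S x -> x = 0].
have [|A [[AT AL AS] Amax]] := @Zorn_bigcup V P.
  move=> F FP Ftot; split.
  - by move=> x [X FX Xx]; have [XT _ _] := FP _ FX; exact: XT.
  - move=> a x y [X FX Xx] [Y FY Yy].
    have [XY|YX] := Ftot X Y FX FY.
      by exists Y => //; have [_ YL _] := FP _ FY; apply: YL => //; exact: XY.
    by exists X => //; have [_ XL _] := FP _ FX; apply: XL => //; exact: YX.
  - by move=> x [X FX Xx]; have [_ _ XS] := FP _ FX; exact: XS.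
have A0 : A 0.
  apply: contrapT => nA0.
  have A_ x : ~ A x.
    by move=> Ax; apply: nA0; have := AL (-1) x x Ax Ax; rewrite scaleN1r addNr.
  apply: (Amax (fun x => x = 0)).
    by split; [move=> x /A_ | move=> /(_ 0 erefl)].
  split=> [x ->|a x y -> ->|//]; first exact: subspace0.
  by rewrite scaler0 addr0.
exists A; split=> // x Tx; apply: contrapT => nx.
(* The line through a vector [x] outside S + A could be adjoined: if a + k x lies in [S] with k
   nonzero, division by k puts [x] in S + A. *)
apply: (Amax (fun y => exists a k, A a /\ y = a + k *: x)).
  split; first by move=> y Ay; exists y, 0; rewrite scale0r addr0.
  move=> BA; apply: nx; exists 0, x; split; [exact: subspace0| |by rewrite add0r].
  by apply: BA; exists 0, 1; rewrite scale1r add0r.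
split.
- by move=> _ [a [k [Aa ->]]]; apply: subspaceD => //; [exact: AT|exact: subspaceZ].
- move=> l _ _ [a [k [Aa ->]]] [b [m [Ab ->]]].
  exists (l *: a + b), (l * k + m); split; first exact: AL.
  by rewrite scalerDl scalerDr scalerA addrACA.
- move=> _ [a [k [Aa ->]]] Sak.
  have [k0|k0] := eqVneq k 0.
    by move: Sak; rewrite k0 scale0r addr0; exact: AS.
  case: nx; exists (k^-1 *: (a + k *: x)), (- k^-1 *: a); split.
  + exact: subspaceZ.
  + by have := AL (- k^-1) a 0 Aa A0; rewrite addr0.
  + by rewrite scalerDr scalerA mulVf // scale1r scaleNr addrAC subrr add0r.
Qed.

End Subspace.

(** * Linear maps given degree by degree *)

Section Grading.
Variables (K : fieldType) (V W : lmodType K) (D : int -> V -> Prop).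
Hypothesis Dgr : is_grading D.

Lemma grading_sub n : subspace (D n). Proof. by case: Dgr. Qed.

Lemma grading_ext (g1 g2 : V -> W) : lin_fun g1 -> lin_fun g2 ->
  (forall n x, D n x -> g1 x = g2 x) -> forall x, g1 x = g2 x.
Proof.
move=> L1 L2 E x; case: Dgr => _ [_ /(_ x) [s [Ds ->]]].
rewrite (lin_fun_sum L1) (lin_fun_sum L2) big_seq [RHS]big_seq.
by apply: eq_bigr => z /Ds [_ /E].
Qed.

(** The value at a vector is read off a chosen decomposition into homogeneous pieces, and
    independence makes the choice irrelevant. Both the homotopy and the sign involution are produced
    this way. *)
Lemma grading_glue (g : int -> V -> W) :
  (forall n a x y, D n x -> D n y -> g n (a *: x + y) = a *: g n x + g n y) ->
  exists G : V -> W, lin_fun G /\ forall n x, D n x -> G x = g n x.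
Proof.
move=> gL.
have g0 n : g n 0 = 0.
  have := gL n (-1) 0 0 (subspace0 (grading_sub n)) (subspace0 (grading_sub n)).
  by rewrite scaler0 addr0 scaleN1r addNr.
have gsum n (s : seq (int * V)) (P : pred (int * V)) :
    (forall z, z \in s -> P z -> D n z.2) ->
    g n (\sum_(z <- s | P z) z.2) = \sum_(z <- s | P z) g n z.2.
  elim: s => [|z s IH] Ds; first by rewrite !big_nil.
  have Ds' z' : z' \in s -> P z' -> D n z'.2.
    by move=> z's; apply: Ds; rewrite inE z's orbT.
  rewrite !big_cons; case: ifP => Pz; last exact: IH.
  rewrite -(IH Ds') -[z.2]scale1r gL ?scale1r //; first by apply: Ds; rewrite ?inE ?eqxx.
  by apply: subspace_sum; [exact: grading_sub|exact: Ds'].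
(* Independence concerns lists with distinct degrees, whereas a decomposition may repeat a degree;
   terms of equal degree are collected first. *)
have wd (s : seq (int * V)) : (forall z, z \in s -> D z.1 z.2) ->
    \sum_(z <- s) z.2 = 0 -> \sum_(z <- s) g z.1 z.2 = 0.
  move=> Ds s0.
  pose ks := undup (map fst s).
  have byk (U : lmodType K) (E : int * V -> U) :
      \sum_(z <- s) E z = \sum_(k <- ks) \sum_(z <- s | z.1 == k) E z.
    rewrite (exchange_big_dep xpredT) //= big_seq [RHS]big_seq.
    apply: eq_bigr => z zs.
    rewrite -big_filter (_ : [seq i <- ks | z.1 == i] = [:: z.1]) ?big_seq1 //.
    under eq_filter => i do rewrite eq_sym.
    by rewrite filter_pred1_uniq ?undup_uniq // mem_undup map_f.
  pose t := [seq (k, \sum_(z <- s | z.1 == k) z.2) | k <- ks].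
  have t0 z : z \in t -> z.2 = 0.
    case: Dgr => _ [/(_ t) ind _]; apply: ind.
    - by rewrite -map_comp map_id undup_uniq.
    - move=> _ /mapP [k _ ->] /=; apply: subspace_sum; first exact: grading_sub.
      by move=> z' z's /eqP <-; exact: Ds.
    - by rewrite big_map -byk.
  rewrite byk big_seq big1 // => k kks.
  rewrite (eq_bigr (fun z => g k z.2)) => [|z /eqP -> //].
  rewrite -gsum => [|z zs /eqP <-]; last exact: Ds.
  by have /= -> := t0 _ (map_f (fun k => (k, \sum_(z <- s | z.1 == k) z.2)) kks).
have /choice[dec decP] (v : V) : exists s : seq (int * V),
    (forall z, z \in s -> D z.1 z.2) /\ v = \sum_(z <- s) z.2.
  case: Dgr => _ [_ /(_ v) [s [Ds vE]]]; exists s.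
  by split=> // z /Ds [].
pose G v := \sum_(z <- dec v) g z.1 z.2.
(* Two decompositions of [v] differ by a relation: [wd] is applied to the chosen one followed by the
   negative of the other. *)
have GE (s : seq (int * V)) v : (forall z, z \in s -> D z.1 z.2) ->
    v = \sum_(z <- s) z.2 -> G v = \sum_(z <- s) g z.1 z.2.
  move=> Ds vE; have [Dv vE'] := decP v.
  pose s' := [seq (z.1, - z.2) | z <- s].
  have gN n x : D n x -> g n (- x) = - g n x.
    move=> Dx; have := gL n (-1) x 0 Dx (subspace0 (grading_sub n)).
    by rewrite g0 !addr0 !scaleN1r.
  have : \sum_(z <- dec v ++ s') g z.1 z.2 = 0.
    apply: wd => [z|].
      rewrite mem_cat => /orP[/Dv //|/mapP [z' z's -> /=]].
      by apply: subspaceN; [exact: grading_sub|exact: Ds].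
    by rewrite big_cat /= big_map /= sumrN -vE' -vE subrr.
  rewrite big_cat /= big_map /= => /eqP; rewrite addr_eq0 => /eqP E.
  rewrite /G E -sumrN big_seq [RHS]big_seq; apply: eq_bigr => z zs.
  by rewrite gN ?opprK //; exact: Ds.
exists G; split=> [a x y|n x Dx].
  have [Dx xE] := decP x; have [Dy yE] := decP y.
  rewrite (GE ([seq (z.1, a *: z.2) | z <- dec x] ++ dec y)); last 2 first.
  - move=> z; rewrite mem_cat => /orP[/mapP [z' z's -> /=]|/Dy //].
    by apply: subspaceZ; [exact: grading_sub|exact: Dx].
  - by rewrite big_cat /= big_map /= -scaler_sumr -xE -yE.
  rewrite big_cat /= big_map /= /G scaler_sumr; congr (_ + _).
  rewrite big_seq [RHS]big_seq; apply: eq_bigr => z /Dx Dz.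
  by have := gL z.1 a z.2 0 Dz (subspace0 (grading_sub _)); rewrite g0 !addr0.
rewrite (GE [:: (n, x)]) ?big_seq1 // => z; by rewrite inE => /eqP ->.
Qed.

End Grading.

(** * Descending induction along a filtration, and its splittings *)

Section Filtration.
Variables (K : fieldType) (V : lmodType K).
Variables (D : int -> V -> Prop) (F : int -> int -> V -> Prop).
Hypothesis FF : is_filtration D F.

Lemma filt_sub p n : subspace (F p n). Proof. by case: FF. Qed.

Lemma filt_deg p n v : F p n v -> D n v. Proof. by case: FF => _ [+ _]; exact. Qed.

Lemma filt_exh n v : D n v -> exists p, F p n v.
Proof. by case: FF => _ [_ [_ [+ _]]]; exact. Qed.

Lemma filt_le p q n v : p <= q -> F q n v -> F p n v.
Proof.
move=> pq; have -> : q = p + (absz (q - p))%:Z by lia.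
elim: (absz _) => [|k IH]; first by rewrite addr0.
move=> Fv; apply: IH; case: FF => _ [_ [+ _]]; apply.
by rewrite -addrA (_ : k%:Z + 1 = k.+1%:Z) //; lia.
Qed.

Lemma filt_zero n : exists N, forall p v, N <= p -> F p n v -> v = 0.
Proof.
case: FF => _ [_ [_ [_ /(_ n) [N N0]]]]; exists N => p v Np /(filt_le Np).
exact: N0.
Qed.

(** Descending induction on the level [p] in a fixed degree; it is well founded because F^p vanishes
    there for large p. *)
Lemma filt_ind n (Q : int -> V -> Prop) :
  (forall p, Q p 0) ->
  (forall p, (forall v, F (p + 1) n v -> Q (p + 1) v) ->
     forall v, F p n v -> Q p v) ->
  forall p v, F p n v -> Q p v.
Proof.
move=> Q0 QS p; have [N N0] := filt_zero n.
have [k] := ubnP (absz (N - p) + (p < N)%R); elim: k p => // k IH p kp v.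
have [Np /(N0 _ _ Np) ->|pN] := lerP N p; first exact: Q0.
apply: QS => w; apply: IH; move: kp; rewrite pN; case: ltP; lia.
Qed.

(** [B q m] is a complement of F^(q+1) in F^q, in degree q + m. In a relation among such pieces the
    one of lowest index is minus a sum of elements of higher filtration, so it lies in F^(q+1) and
    vanishes. *)
Lemma filtration_split : exists B : int -> int -> V -> Prop,
  [/\ forall q m, subspace (B q m), forall n, indep (fun q => B q (n - q)) &
      forall p n v, F p n v <-> spanned (fun q => B q (n - q)) (fun q => p <= q) v].
Proof.
have /choice[C CP] : forall pn : int * int, exists C : V -> Prop,
  [/\ subspace C, forall x, C x -> F pn.1 pn.2 x,
      forall x, C x -> F (pn.1 + 1) pn.2 x -> x = 0 &
      forall x, F pn.1 pn.2 x -> exists s c, [/\ F (pn.1 + 1) pn.2 s, C c & x = s + c]].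
  move=> [p n]; exact: (subspace_complement (filt_sub (p + 1) n) (filt_sub p n)).
exists (fun q m => C (q, q + m)); split.
- by move=> q m; case: (CP (q, q + m)).
- move=> n s us sC s0.
  have {}sC z : z \in s -> C (z.1, n) z.2.
    by move=> /sC; rewrite (_ : z.1 + (n - z.1) = n) //; lia.
  (* Adding [M] makes every index in the list nonnegative, which permits induction from the lowest
     index upwards. *)
  pose M := (\max_(z <- s) absz z.1)%N.
  have sM z : z \in s -> 0 <= z.1 + M%:Z.
    by move=> zs; have := leq_bigmax_seq (F := fun z => absz z.1) z zs isT; rewrite -/M; lia.
  suff H k z : z \in s -> (absz (z.1 + M%:Z)%R < k)%N -> z.2 = 0.
    by move=> z zs; exact: (H (absz (z.1 + M%:Z)).+1).
  elim: k z => // k IH z zs; rewrite ltnS => kz.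
  have [_ _ Cz _] := CP (z.1, n); apply: Cz; first exact: sC.
  have us' : uniq s by exact: map_uniq us.
  move: s0; rewrite (bigD1_seq z) //= => /eqP; rewrite addr_eq0 => /eqP ->.
  apply: subspaceN; first exact: filt_sub.
  apply: subspace_sum => [|y ys yz]; first exact: filt_sub.
  have [yz1|zy1|e1] := ltgtP y.1 z.1.
  + rewrite (IH y) //; first exact: (subspace0 (filt_sub _ _)).
    by have := sM y ys; have := sM z zs; lia.
  + have [_ CF _ _] := CP (y.1, n); have := CF _ (sC _ ys); by apply: filt_le; rewrite lezD1.
  + case/negP: yz; apply/eqP.
    exact: (uniq_map_inj us).
- move=> p n v; split; last first.
    move=> [s [sC ->]]; apply: subspace_sum => [|z /sC [pz Cz] _]; first exact: filt_sub.
    have [_ CF _ _] := CP (z.1, z.1 + (n - z.1)).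
    apply: (filt_le pz); have := CF _ Cz; rewrite /= (_ : z.1 + (n - z.1) = n) //; lia.
  move: p v; apply: filt_ind => [p|p IH v Fv].
    by exists [::]; rewrite big_nil.
  have [_ _ _ /(_ v Fv) [s [c [Fs Cc ->]]]] := CP (p, n).
  have [t [tC ->]] := IH _ Fs.
  exists ((p, c) :: t); split; last by rewrite big_cons addrC.
  move=> z; rewrite inE => /orP[/eqP -> /=|/tC [pz Cz]].
    by rewrite (_ : p + (n - p) = n) //; lia.
  by split=> //; lia.
Qed.

End Filtration.

(** * The filtered homotopy *)

Section Contraction.
Variables (K : fieldType) (V : lmodType K).
Variables (D : int -> V -> Prop) (F : int -> int -> V -> Prop) (d : V -> V).
Hypotheses (Dgr : is_grading D) (FF : is_filtration D F) (dL : lin_fun d).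
Hypothesis dd : forall x, d (d x) = 0.
Hypothesis dF : forall p n v, F p n v -> F p (n + 1) (d v).

(** Representatives of the cycles of the quotient complex F^p / F^(p+1). *)
Let Z p n x := F p n x /\ F (p + 1) (n + 1) (d x).

Let Z_sub p n : subspace (Z p n).
Proof.
split=> [|a x y [Fx Fdx] [Fy Fdy]].
  by rewrite /Z (lin_fun0 dL); split; exact: subspace0 (filt_sub FF _ _).
by split; [|rewrite dL]; apply: (filt_sub FF _ _).2.
Qed.

Let FZ p n x : F (p + 1) n x -> Z p n x.
Proof.
move=> Fx; split; last exact: dF.
by apply: (filt_le FF) Fx; lia.
Qed.

(* [C p n] represents a complement of the cycles of the graded differential,
   and [H p n] its cohomology: F^p = F^(p+1) + d C + H + C, a direct sum. *)
Let split_cycles : exists C H : int -> int -> V -> Prop,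
  [/\ forall p n, subspace (C p n), forall p n, subspace (H p n),
      forall p n x, C p n x -> F p n x /\ (Z p n x -> x = 0),
      forall p n x, H p n x -> Z p n x &
      [/\ forall p n x c u, H p n x -> C p (n - 1) c -> F (p + 1) n u ->
            x = u + d c -> x = 0 &
      forall p n x, F p n x -> exists u c e c',
        [/\ F (p + 1) n u, C p (n - 1) c, H p n e, C p n c' &
            x = u + d c + e + c']]].
Proof.
have /choice[C CP] : forall pn : int * int, exists C : V -> Prop,
  [/\ subspace C, forall x, C x -> F pn.1 pn.2 x,
      forall x, C x -> Z pn.1 pn.2 x -> x = 0 &
      forall x, F pn.1 pn.2 x -> exists s c, [/\ Z pn.1 pn.2 s, C c & x = s + c]].
  move=> [p n]; exact: (subspace_complement (Z_sub p n) (filt_sub FF p n)).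
(* Representatives of the boundaries of the quotient complex: [d] of [C] accounts for [d] of all of
   F^p, because F^p = Z + C and [d] sends [Z] into F^(p+1). *)
pose T p n x := exists u c, [/\ F (p + 1) n u, C (p, n - 1) c & x = u + d c].
have T_sub p n : subspace (T p n).
  have [CS _ _ _] := CP (p, n - 1); split.
    exists 0, 0; rewrite (lin_fun0 dL) addr0; split=> //; last exact: subspace0.
    exact: subspace0 (filt_sub FF _ _).
  move=> a _ _ [u [c [Fu Cc ->]]] [v [e [Fv Ce ->]]].
  exists (a *: u + v), (a *: c + e); split; [exact: (filt_sub FF _ _).2|exact: CS.2|].
  by rewrite dL scalerDr addrACA.
have /choice[H HP] : forall pn : int * int, exists C : V -> Prop,
  [/\ subspace C, forall x, C x -> Z pn.1 pn.2 x,
      forall x, C x -> T pn.1 pn.2 x -> x = 0 &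
      forall x, Z pn.1 pn.2 x -> exists s c, [/\ T pn.1 pn.2 s, C c & x = s + c]].
  move=> [p n]; exact: (subspace_complement (T_sub p n) (Z_sub p n)).
exists (fun p n => C (p, n)), (fun p n => H (p, n)); split.
- by move=> p n; case: (CP (p, n)).
- by move=> p n; case: (HP (p, n)).
- by move=> p n x Cx; case: (CP (p, n)) => _ CF CZ _; split; [exact: CF|exact: CZ].
- by move=> p n x Hx; case: (HP (p, n)) => _ HZ _ _; exact: HZ.
split.
- move=> p n x c u Hx Cc Fu xE; case: (HP (p, n)) => _ _ + _; apply => //.
  by exists u, c.
- move=> p n x Fx; have [_ _ _ /(_ x Fx) [s [c' [Zs Cc' ->]]]] := CP (p, n).
  have [_ _ _ /(_ s Zs) [t [e [[u [c [Fu Cc ->]]] He ->]]]] := HP (p, n).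
  by exists u, c, e, c'.
Qed.

(* The graph of the homotopy restricted to F^p V^n: it sends [d c] to [c] and
   kills [H] and [C]. *)
Inductive homotopy_graph (C H : int -> int -> V -> Prop) (n : int) :
    int -> V -> V -> Prop :=
| HomotopyZero p : homotopy_graph C H n p 0 0
| HomotopyStep p c e c' x y : C p (n - 1) c -> H p n e -> C p n c' ->
    homotopy_graph C H n (p + 1) x y ->
    homotopy_graph C H n p (x + d c + e + c') (y + c).

(** The map is recovered from its graph: values exist by descending induction, the graph is linear,
    and uniqueness reduces to [R0]. A relation is convenient because the level at which the
    recursion stops depends on the degree and is only known to exist. *)
Theorem filtered_contraction : exists h : V -> V,
  [/\ lin_fun h, forall p n v, F p n v -> F p (n - 1) (h v),
      forall x, h (h x) = 0, forall x, h (d (h x)) = h x &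
      forall p n x, F p n x -> h x = 0 -> h (d x) = 0 -> F (p + 1) (n + 1) (d x)].
Proof.
have [C [H [C_sub H_sub CP HZ [HT FP]]]] := split_cycles.
pose R := homotopy_graph C H.
have R_step n p c e c' x y X Y : C p (n - 1) c -> H p n e -> C p n c' ->
    R n (p + 1) x y -> X = x + d c + e + c' -> Y = y + c -> R n p X Y.
  by move=> Cc He Cc' Rxy -> ->; exact: HomotopyStep.
have RF n p x y : R n p x y -> F p n x /\ F p (n - 1) y.
  elim=> {p x y} [p|p c e c' x y Cc He Cc' _ [Fx Fy]].
    by split; exact: subspace0 (filt_sub FF _ _).
  have le1 : p <= p + 1 by lia.
  have [Fc _] := CP _ _ _ Cc; have [Fc' _] := CP _ _ _ Cc'; have [Fe _] := HZ _ _ _ He.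
  split; repeat (apply: subspaceD; first exact: filt_sub FF _ _) => //;
    try by apply: (filt_le FF le1).
  by rewrite -[n](subrK 1); exact: dF.
have RL n p a x y x' y' : R n p x y -> R n p x' y' -> R n p (a *: x + x') (a *: y + y').
  move=> Rxy; elim: Rxy x' y' => {p x y} [p|p c e c' x y Cc He Cc' Rxy IH] x' y'.
    by rewrite !scaler0 !add0r.
  have S0 := subspace0; have IH0 := IH 0 0 (HomotopyZero _ _ _ _).
  move=> Rxy'; case: Rxy' IH Cc He Cc' Rxy IH0 => {p x' y'}.
    move=> p IH Cc He Cc' Rxy IH0; apply: (R_step _ _ (a *: c) (a *: e) (a *: c')).
    - exact: subspaceZ.
    - exact: subspaceZ.
    - exact: subspaceZ.
    - exact: IH0.
    - by rewrite (lin_funZ dL) !addr0 !scalerDr.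
    - by rewrite !addr0 !scalerDr.
  move=> p f g f' x' y' Cf Hg Cf' Rxy' IH Cc He Cc' Rxy _.
  apply: (R_step _ _ (a *: c + f) (a *: e + g) (a *: c' + f')).
  - exact: (C_sub _ _).2.
  - exact: (H_sub _ _).2.
  - exact: (C_sub _ _).2.
  - exact: (IH _ _ Rxy').
  - rewrite dL !scalerDr addrACA; congr (_ + _).
    by rewrite addrACA; congr (_ + _); exact: addrACA.
  - by rewrite scalerDr addrACA.
have CF0 p n c : C p n c -> F (p + 1) n c -> c = 0.
  by move=> Cc Fc; apply: (CP _ _ _ Cc).2; exact: FZ.
have dC0 p n c : C p n c -> F (p + 1) (n + 1) (d c) -> c = 0.
  by move=> Cc Fc; have [? +] := CP _ _ _ Cc; apply.
(* The decomposition is direct: c' is a sum of graded cycles, hence 0; then e is a graded boundary,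
   hence 0; then d c lies in F^(p+1), hence c = 0. What remains is the same question one level
   up. *)
have R0 n p x y : R n p x y -> x = 0 -> y = 0.
  elim=> {p x y} // p c e c' x y Cc He Cc' Rxy IH E.
  have [Fx Fy] := RF _ _ _ _ Rxy.
  have e1 : n - 1 + 1 = n by lia.
  have Zdc : Z p n (d c).
    split; last by rewrite dd; exact: subspace0 (filt_sub FF _ _).
    by rewrite -e1; apply: dF; have [] := CP _ _ _ Cc.
  have c'0 : c' = 0.
    apply: (CP _ _ _ Cc').2.
    have -> : c' = - (x + d c + e) by apply/eqP; rewrite -addr_eq0 addrC E.
    apply: subspaceN (Z_sub _ _) _; apply: subspaceD (Z_sub _ _) _ (HZ _ _ _ He).
    exact: subspaceD (Z_sub _ _) (FZ Fx) Zdc.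
  have e0 : e = 0.
    apply: (HT p n e (- c) (- x)) => //; [exact: subspaceN|exact: subspaceN (filt_sub FF _ _) _|].
    by apply/eqP; rewrite (lin_funN dL) -opprD -addr_eq0 addrC; move: E; rewrite c'0 addr0 => ->.
  move: E; rewrite c'0 e0 !addr0 => E.
  have c0 : c = 0.
    apply: (dC0 _ _ _ Cc); rewrite e1.
    have -> : d c = - x by apply/eqP; rewrite -addr_eq0 addrC E.
    exact: subspaceN (filt_sub FF _ _) _.
  by move: E; rewrite c0 (lin_fun0 dL) !addr0; exact: IH.
have Rtot n : forall p x, F p n x -> exists y, R n p x y.
  apply: (filt_ind FF) => [p|p IH x Fx]; first by exists 0; exact: HomotopyZero.
  have [u [c [e [c' [Fu Cc He Cc' ->]]]]] := FP _ _ _ Fx.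
  by have [y Ry] := IH _ Fu; exists (y + c); exact: HomotopyStep.
(* Padding with zero components moves a pair to a lower level, so that values found at different
   levels can be compared. *)
have Rle n p q x y : p <= q -> R n q x y -> R n p x y.
  move=> pq; have -> : q = p + (absz (q - p))%:Z by lia.
  elim: (absz _) => [|k IH]; first by rewrite addr0.
  rewrite (_ : p + k.+1%:Z = p + k%:Z + 1); last by lia.
  move=> Rxy; apply: IH; have S0 := subspace0.
  apply: (R_step _ _ 0 0 0 _ _ _ _ _ _ _ Rxy); [exact: S0|exact: S0|exact: S0| |].
    by rewrite (lin_fun0 dL) !addr0.
  by rewrite addr0.
have Runiq n p q x y y' : R n p x y -> R n q x y' -> y = y'.
  wlog pq : p q y y' / p <= q.
    move=> WL Rp Rq; case/orP: (le_total p q) => pq.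
      exact: (WL p q y y').
    by symmetry; exact: (WL q p y' y).
  move=> Rp /(Rle _ _ _ _ _ pq) Rq; apply/eqP; rewrite -subr_eq0; apply/eqP.
  have := RL _ _ (-1) _ _ _ _ Rq Rp; rewrite !scaleN1r !(addrC (- _)).
  by move/R0; apply; exact: subrr.
have /choice[g gP] : forall nx : int * V, exists y,
    D nx.1 nx.2 -> exists p, R nx.1 p nx.2 y.
  move=> [n x] /=; case: (pselect (D n x)) => [Dx|]; last by exists 0.
  have [p Fx] := filt_exh FF Dx; have [y Ry] := Rtot _ _ _ Fx.
  by exists y => _; exists p.
have gE n p x y : R n p x y -> g (n, x) = y.
  move=> Rxy; have [Fx _] := RF _ _ _ _ Rxy.
  by have [q Rq] := gP (n, x) (filt_deg FF Fx); exact: Runiq Rq Rxy.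
have [|h [hL hE]] := @grading_glue K V V D Dgr (fun n x => g (n, x)).
  move=> n a x y Dx Dy.
  have [p Rp] := gP (n, x) Dx; have [q Rq] := gP (n, y) Dy.
  have minp : Order.min p q <= p by rewrite ge_min lexx.
  have minq : Order.min p q <= q by rewrite ge_min lexx orbT.
  have Rp' := Rle _ _ _ _ _ minp Rp.
  have Rq' := Rle _ _ _ _ _ minq Rq.
  exact: gE (RL _ _ _ _ _ _ _ Rp' Rq').
have hR n p x : F p n x -> R n p x (h x).
  move=> Fx; have [y Ry] := Rtot _ _ _ Fx.
  by rewrite (hE n x (filt_deg FF Fx)) (gE _ _ _ _ Ry).
have Rh n p x y : R n p x y -> h x = y.
  move=> Rxy; have [Fx _] := RF _ _ _ _ Rxy.
  by rewrite (hE n x (filt_deg FF Fx)) (gE _ _ _ _ Rxy).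
have hF p n v : F p n v -> F p (n - 1) (h v) by move=> /hR /RF [].
exists h; split=> //.
- apply: (grading_ext Dgr) => [a x y|a x y|n x Dx].
  + by rewrite !hL.
  + by rewrite scaler0 addr0.
  have [p /hR Rx] := filt_exh FF Dx.
  (* [h x] is a sum of elements of [C], and in degree n - 1 each of them enters as the last
     component, which the graph kills. *)
  suff: R (n - 1) p (h x) 0 by exact: Rh.
  elim: Rx => [q|q c e c' u v Cc _ _ _ IH]; first exact: HomotopyZero.
  apply: (R_step _ _ 0 0 c _ _ _ _ _ _ _ IH) => //; try exact: subspace0.
    by rewrite (lin_fun0 dL) !addr0.
  by rewrite addr0.
- apply: (grading_ext Dgr) => [a x y|//|n x Dx].
  + by rewrite hL dL hL.
  have [p /hR Rx] := filt_exh FF Dx.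
  (* [d (h x)] is a sum of terms d c, each of which the graph sends back to c. *)
  suff: R n p (d (h x)) (h x) by exact: Rh.
  elim: Rx => [q|q c e c' u v Cc _ _ _ IH]; first by rewrite (lin_fun0 dL); exact: HomotopyZero.
  apply: (R_step _ _ c 0 0 _ _ _ _ _ _ _ IH) => //; try exact: subspace0.
  by rewrite (lin_funD dL) !addr0.
(* From h x = 0 it follows that c lies in F^(p+1); from h (d x) = 0 the same follows for c', because
   h (d c') = c'. Elements of [C] in F^(p+1) vanish, so x = u + e, whose differential rises in
   filtration. *)
- move=> p n x Fx hx hdx.
  have [u [c [e [c' [Fu Cc He Cc' xE]]]]] := FP _ _ _ Fx.
  have /hR Ru := Fu.
  have hxE : h x = h u + c by apply: (Rh n p); rewrite xE; exact: HomotopyStep.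
  have c0 : c = 0.
    apply: (CF0 _ _ _ Cc); have -> : c = - h u.
      by apply/eqP; rewrite -addr_eq0 addrC -hxE hx.
    by apply: subspaceN (filt_sub FF _ _) _; exact: hF.
  have dxE : d x = d (u + e) + d c'.
    by rewrite xE c0 (lin_fun0 dL) addr0 (lin_funD dL).
  have Fue : F (p + 1) (n + 1) (d (u + e)).
    rewrite (lin_funD dL); apply: subspaceD (filt_sub FF _ _) (dF Fu) _.
    by have [] := HZ _ _ _ He.
  have hdc' : h (d c') = c'.
    apply: (Rh (n + 1) p).
    apply: (R_step _ _ c' 0 0 0 0) => //; rewrite ?add0r ?addr0 ?addrK //;
      try exact: subspace0.
    exact: HomotopyZero.
  have c'0 : c' = 0.
    apply: (CF0 _ _ _ Cc'); have -> : c' = - h (d (u + e)).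
      by apply/eqP; rewrite -addr_eq0 addrC -{1}hdc' -(lin_funD hL) -dxE hdx.
    by apply: subspaceN (filt_sub FF _ _) _; rewrite -[n](addrK 1); exact: hF.
  by rewrite dxE c'0 (lin_fun0 dL) addr0.
Qed.

End Contraction.

(** * Signs with integer exponents *)

Section Signs.
Variable K : fieldType.

Lemma sgnD a b : sgn K (a + b) = sgn K a * sgn K b.
Proof.
rewrite /sgn -signr_addb; congr (_ ^+ nat_of_bool _).
by lia.
Qed.

Lemma sgn0 : sgn K 0 = 1. Proof. by []. Qed.

Lemma sgn_nat n : sgn K n%:Z = (-1) ^+ n.
Proof. by rewrite /sgn signr_odd. Qed.

(** Sign comparisons become polynomial identities: here and in [sgn_opp] the number [z], half the
    even part of the difference of exponents, is supplied explicitly and [ring] finishes. *)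
Lemma sgn_congr a b z : a = b + 2 * z -> sgn K a = sgn K b.
Proof.
move=> ->; rewrite sgnD [sgn K (2 * z)](_ : _ = 1) ?mulr1 // /sgn.
by rewrite (_ : odd _ = false) //; lia.
Qed.

Lemma sgn_opp a b z : a = b + 2 * z + 1 -> sgn K a = - sgn K b.
Proof.
by move=> ->; rewrite sgnD (@sgn_congr _ b z) // /sgn /= expr1 mulrN1.
Qed.

End Signs.

Lemma isum_cat u v : isum (u ++ v) = isum u + isum v.
Proof. by rewrite /isum big_cat. Qed.

Lemma isum_cons a u : isum (a :: u) = a + isum u.
Proof. by rewrite /isum big_cons. Qed.

Lemma dsumD u k l : dsum u (k + l) = dsum u k + isum (take l (drop k u)).
Proof. by rewrite /dsum takeD isum_cat. Qed.

(** * Words of homogeneous elements and multilinearity *)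

Section Hom.
Variables (I V : Type) (P : I -> V -> Prop).

(** A list-recursive form of [homog], well suited to [take], [drop] and concatenation. The index
    type is arbitrary so that it can carry degrees, or pairs of a filtration level and a degree. *)
Fixpoint all_hom (ks : seq I) (xs : seq V) : Prop :=
  match ks, xs with
  | [::], [::] => True
  | k :: ks', x :: xs' => P k x /\ all_hom ks' xs'
  | _, _ => False
  end.

Lemma all_hom_size ks xs : all_hom ks xs -> size ks = size xs.
Proof. by elim: ks xs => [|k ks IH] [|x xs] //= [_ /IH ->]. Qed.

Lemma all_hom_cat ks ls xs ys :
  all_hom ks xs -> all_hom ls ys -> all_hom (ks ++ ls) (xs ++ ys).
Proof. by elim: ks xs => [|k ks IH] [|x xs] //= [Px /IH H] /H. Qed.

Lemma all_hom_take r ks xs : all_hom ks xs -> all_hom (take r ks) (take r xs).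
Proof.
elim: ks xs r => [|k ks IH] [|x xs] [|r] //= [Px H].
by split=> //; exact: IH.
Qed.

Lemma all_hom_drop r ks xs : all_hom ks xs -> all_hom (drop r ks) (drop r xs).
Proof. by elim: ks xs r => [|k ks IH] [|x xs] [|r] //= [_ H]; exact: IH. Qed.

End Hom.

Lemma all_hom_imply (I V : Type) (P Q : I -> V -> Prop) ks xs :
  (forall k x, P k x -> Q k x) -> all_hom P ks xs -> all_hom Q ks xs.
Proof.
by move=> PQ; elim: ks xs => [|k ks IH] [|x xs] //= [/PQ Px /IH].
Qed.

Lemma homogP (K : fieldType) (V : lmodType K) (D : int -> V -> Prop) n ns xs :
  homog D n ns xs <-> size xs = n /\ all_hom D ns xs.
Proof.
split.
  move=> [sn [sx H]]; split=> //; move: n xs sn sx H.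
  elim: ns => [|k ns IH] n [|x xs] //=; [by move=> <-| by move=> <-|].
  case: n => // n [sn] [sx] H; split; first exact: (H 0%N).
  by apply: (IH n) => // i ni; exact: (H i.+1).
move=> [sx H]; have sn := all_hom_size H; split; [by rewrite sn|split=> //].
move: n sx {sn}; elim: ns xs H => [|k ns IH] [|x xs] //=; first by move=> _ n <-.
by move=> [Dx H] [|n] //= [sx] [|i] //=; move=> si; exact: (IH xs H n sx i).
Qed.

Section Multilin.
Variables (K : fieldType) (V W : lmodType K).

Lemma multilinP s (g : seq V -> W) : multilin s g <->
  (forall u v a x y, (size u + (size v).+1)%N = s ->
     g (u ++ (a *: x + y) :: v) = a *: g (u ++ x :: v) + g (u ++ y :: v)).
Proof.
have setE (u v : seq V) z x : set_nth 0 (u ++ z :: v) (size u) x = u ++ x :: v.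
  by elim: u => //= w u ->.
split=> H.
  move=> u v a x y suv.
  have := H (u ++ 0 :: v) (size u) a x y; rewrite !setE; apply; rewrite ?size_cat //=.
  by rewrite -suv addnS ltnS leq_addr.
move=> xs i a x y sx si.
have {}si : (i < size xs)%N by rewrite sx.
rewrite !set_nthE si H // size_takel ?(ltnW si) // size_drop; move: si; rewrite sx; lia.
Qed.

End Multilin.

Lemma sum_nat_ge (U : nmodType) k l n (E : nat -> U) : (l <= k)%N ->
  \sum_(l <= i < n | (k <= i)%N) E i = \sum_(k <= i < n) E i.
Proof. by move=> lk; rewrite [RHS](big_nat_widenl _ l). Qed.

Lemma sum_nat_shift (U : nmodType) k n (E : nat -> U) :
  \sum_(k <= i < n) E i = \sum_(0 <= i < n - k) E (i + k)%N.
Proof. by rewrite -{1}[k]add0n big_addn. Qed.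

(** * Stasheff sums *)

Section Stasheff.
Variables (K : fieldType) (V W : lmodType K).
Variables (m : nat -> seq V -> V) (g : nat -> seq V -> W).

(** Inner operation [m] and outer operation [g] are kept apart: one sum then serves the Stasheff
    relations, the left side of the morphism relations and the identity for [lam]. *)
Definition stasheff_term n ns xs r s : W :=
  sgn K ((r + s * (n - r - s))%N%:Z + (s%:Z * dsum ns r)) *:
    g (r + 1 + (n - r - s))%N
      (take r xs ++ m s (take s (drop r xs)) :: drop (r + s) xs).

Definition stasheff n ns xs : W :=
  \sum_(0 <= r < n.+1) \sum_(0 <= s < n.+1 | (0 < s)%N && (r + s <= n)%N)
     stasheff_term n ns xs r s.

Lemma stasheff_widen N n ns xs : (n <= N)%N -> stasheff n ns xs =
  \sum_(0 <= r < N.+1) \sum_(0 <= s < N.+1 | (0 < s)%N && (r + s <= n)%N)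
     stasheff_term n ns xs r s.
Proof.
move=> nN; rewrite /stasheff (big_nat_widen _ _ N.+1) //.
rewrite big_mkcond /=; apply: eq_bigr => r _; case: ifP => rn.
  rewrite (big_nat_widen _ _ N.+1) //; apply: eq_bigl => s; lia.
by rewrite big_pred0 // => s; lia.
Qed.

End Stasheff.

(** * Transfer of the product along the homotopy, carried out inside [V] *)

Section Transfer.
Variables (K : fieldType) (V : lmodType K).
Variables (D : int -> V -> Prop) (F : int -> int -> V -> Prop).
Variables (d : V -> V) (mu : V -> V -> V) (h eps : V -> V).
Hypotheses (FF : is_filtration D F) (Dgr : is_grading D).
Hypotheses (dL : lin_fun d) (hL : lin_fun h) (epsL : lin_fun eps) (muL : bilin mu).
Hypothesis dd : forall x, d (d x) = 0.
Hypothesis muA : forall x y z, mu (mu x y) z = mu x (mu y z).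
Hypothesis dmu : forall n x y, D n x -> d (mu x y) = mu (d x) y + sgn K n *: mu x (d y).
Hypothesis dF : forall p n v, F p n v -> F p (n + 1) (d v).
Hypothesis muF : forall p q n m x y, F p n x -> F q m y -> F (p + q) (n + m) (mu x y).
Hypothesis hF : forall p n v, F p n v -> F p (n - 1) (h v).
Hypothesis hh : forall x, h (h x) = 0.
Hypothesis hdh : forall x, h (d (h x)) = h x.
Hypothesis epsE : forall n x, D n x -> eps x = sgn K n *: x.

Let muLl y : lin_fun (mu ^~ y). Proof. exact: muL.1. Qed.
Let muLr x : lin_fun (mu x). Proof. exact: muL.2. Qed.
Let F_sub p n : subspace (F p n). Proof. exact: filt_sub FF p n. Qed.
Let D_sub n : subspace (D n). Proof. exact: grading_sub Dgr n. Qed.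

Definition harm x := x - d (h x) - h (d x).

Lemma harm_lin : lin_fun harm.
Proof.
move=> a x y; rewrite /harm dL !hL dL !scalerBr !opprD.
by rewrite [RHS]addrACA; congr (_ + _); exact: addrACA.
Qed.

Lemma harm_d x : harm (d x) = d (harm x).
Proof.
by rewrite /harm !(lin_funB dL) dd dd (lin_fun0 hL) !subr0.
Qed.

Lemma h_harm x : h (harm x) = 0.
Proof. by rewrite /harm !(lin_funB hL) hdh hh subr0 subrr. Qed.

Lemma harm_idem x : harm (harm x) = harm x.
Proof. by rewrite {1}/harm -harm_d !h_harm (lin_fun0 dL) !subr0. Qed.

Lemma harm_F p n x : F p n x -> F p n (harm x).
Proof.
move=> Fx; rewrite /harm; apply: subspaceB => //; first apply: subspaceB => //.
  by rewrite -[n](subrK 1); apply: dF; exact: hF.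
by rewrite -[n](addrK 1); apply: hF; exact: dF.
Qed.

Lemma iter_eps_lin k : lin_fun (iter k eps).
Proof. by elim: k => // k IH a x y; rewrite /= IH epsL. Qed.

Lemma iter_eps k n x : D n x -> iter k eps x = sgn K (k%:Z * n) *: x.
Proof.
move=> Dx; elim: k => [|k IH]; first by rewrite mul0r sgn0 scale1r.
rewrite /= IH (@epsE n); last exact: subspaceZ.
by rewrite scalerA -sgnD; congr (sgn K _ *: _); lia.
Qed.

(* The powers of [eps] and the constant produce the Koszul sign of
   mu (f_i (x) f_(n-i)) without reference to the degrees of the inputs. *)
Definition quad (g : nat -> seq V -> V) n xs :=
  \sum_(1 <= i < n) (-1) ^+ (i.-1 * (n - i)) *:
    mu (iter (n - i).-1 eps (g i (take i xs))) (g (n - i)%N (drop i xs)).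

Definition transfer_step (g : nat -> seq V -> V) n xs :=
  if n == 1%N then nth 0 xs 0 else - h (quad g n xs).

(** Course-of-values recursion, since arity n uses all lower arities: level [k] is meant to be read
    only in arities up to [k], where all later levels agree with it. *)
Fixpoint transfer_upto k : nat -> seq V -> V :=
  if k is k'.+1 then
    fun n => if (n <= k')%N then transfer_upto k' n
             else transfer_step (transfer_upto k') n
  else fun _ _ => 0.

Definition transfer n := transfer_upto n n.

Lemma transfer_uptoE k n : (n <= k)%N -> transfer_upto k n = transfer n.
Proof.
elim: k => [|k IH]; first by rewrite leqn0 => /eqP ->.
rewrite leq_eqVlt => /orP[/eqP -> //|]; rewrite ltnS => nk.
by rewrite /= nk IH.
Qed.

Definition lam n := quad transfer n.

Lemma lam1 xs : lam 1 xs = 0. Proof. by rewrite /lam /quad big_geq. Qed.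

Lemma transfer1 xs : transfer 1 xs = nth 0 xs 0. Proof. by []. Qed.

Lemma transferE n xs : (1 < n)%N -> transfer n xs = - h (lam n xs).
Proof.
have transferS k : transfer k.+1 = transfer_step (transfer_upto k) k.+1.
  by rewrite /transfer /= ltnn.
case: n => [|[|n]] // _; rewrite transferS /transfer_step [_ == _]/=.
congr (- h _); rewrite /lam /quad; apply: eq_big_nat => i /andP[i1 i2].
rewrite !(@transfer_uptoE n.+1) //; lia.
Qed.

(** One shape for all arities, a term present only in arity 1 plus a linear map applied to [lam], as
    [stasheff_split] expects; [minopE] does the same for [minop]. *)
Lemma transferE1 n xs : (0 < n)%N ->
  transfer n xs = (if n == 1%N then nth 0 xs 0 else 0) - h (lam n xs).
Proof.
case: n => [|[|n]] // _; first by rewrite lam1 (lin_fun0 hL) subr0.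
by rewrite transferE // add0r.
Qed.

Definition minop n xs := if n == 1%N then d (nth 0 xs 0) else harm (lam n xs).

Lemma minopE n xs :
  minop n xs = (if n == 1%N then d (nth 0 xs 0) else 0) + harm (lam n xs).
Proof.
rewrite /minop; case: eqP => [->|_]; last by rewrite add0r.
by rewrite lam1 (lin_fun0 harm_lin) addr0.
Qed.

Let multilinQ s (g : seq V -> V) :=
  forall u v a x y, (size u + (size v).+1)%N = s ->
     g (u ++ (a *: x + y) :: v) = a *: g (u ++ x :: v) + g (u ++ y :: v).

Let quad_multilin n : (forall i, (0 < i < n)%N -> multilinQ i (transfer i)) ->
  multilinQ n (lam n).
Proof.
move=> IH u v a x y suv.
rewrite /lam /quad scaler_sumr -big_split /=; apply: eq_big_nat => i /andP[i1 i2].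
rewrite scalerA [a * _]mulrC -scalerA -scalerDr; congr (_ *: _).
(* The varied argument belongs to the right factor when [i <= size u] and to the left factor
   otherwise. *)
have [iu|ui] := leqP i (size u).
  rewrite !takel_cat // !drop_cat.
  have dE z : (if (i < size u)%N then drop i u ++ z :: v
    else drop (i - size u) (z :: v)) = drop i u ++ z :: v.
    by case: ltnP => // ui; rewrite (_ : i = size u) ?subnn ?drop_size //; lia.
  rewrite !dE IH; [exact: muLr|lia|]; rewrite size_drop; lia.
have tE z : take i (u ++ z :: v) = u ++ z :: take (i - size u).-1 v.
  by rewrite take_cat ltnNge (ltnW ui) /=; have -> : (i - size u = (i - size u).-1.+1)%N by lia.
have dE z : drop i (u ++ z :: v) = drop (i - size u).-1 v.
  by rewrite drop_cat ltnNge (ltnW ui) /=; have -> : (i - size u = (i - size u).-1.+1)%N by lia.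
rewrite !tE !dE IH; last 2 first.
- by rewrite i1.
- by rewrite size_takel; lia.
by rewrite iter_eps_lin muLl.
Qed.

Let transfer_multilinQ n : (0 < n)%N -> multilinQ n (transfer n).
Proof.
elim/ltn_ind: n => n IH n0 u v a x y suv.
have [n1|n1] := leqP n 1.
  have -> : n = 1%N by lia.
  by case: u suv => [|z u] /=; [rewrite !transfer1|lia].
have lamL : multilinQ n (lam n).
  by apply: quad_multilin => i /andP[i0 ni]; exact: IH.
by rewrite !transferE // lamL // hL opprD scalerN.
Qed.

Lemma transfer_multilin n : (0 < n)%N -> multilin n (transfer n).
Proof. by move=> n0; apply/multilinP; exact: transfer_multilinQ. Qed.

Lemma lam_multilin n : multilin n (lam n).
Proof.
by apply/multilinP; apply: quad_multilin => i /andP[i0 _]; exact: transfer_multilinQ.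
Qed.

Let FP (q : int * int) := F q.1 q.2.
Let fsum (qs : seq (int * int)) := \sum_(q <- qs) q.1.
Let gsum (qs : seq (int * int)) := \sum_(q <- qs) q.2.

Let lam_F_step n : (forall i qs xs, (0 < i < n)%N -> size xs = i -> all_hom FP qs xs ->
    F (fsum qs) (gsum qs + 1 - i%:Z) (transfer i xs)) ->
  forall qs xs, size xs = n -> all_hom FP qs xs ->
    F (fsum qs) (gsum qs + 2 - n%:Z) (lam n xs).
Proof.
move=> IH qs xs sx H; rewrite /lam /quad.
apply: subspace_sum => // i; rewrite mem_index_iota => /andP[i1 i2] _.
apply: subspaceZ => //.
have F1 : F (fsum (take i qs)) (gsum (take i qs) + 1 - i%:Z) (transfer i (take i xs)).
  apply: IH; [lia|by rewrite size_takel // sx ltnW|exact: all_hom_take].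
have F2 : F (fsum (drop i qs)) (gsum (drop i qs) + 1 - (n - i)%N%:Z)
    (transfer (n - i) (drop i xs)).
  apply: IH; [lia|by rewrite size_drop sx|exact: all_hom_drop].
have {}F1 : F (fsum (take i qs)) (gsum (take i qs) + 1 - i%:Z)
    (iter (n - i).-1 eps (transfer i (take i xs))).
  by rewrite (iter_eps _ (filt_deg FF F1)); exact: subspaceZ.
have := muF F1 F2; rewrite {1}/fsum -big_cat cat_take_drop.
have -> // : gsum (take i qs) + 1 - i%:Z + (gsum (drop i qs) + 1 - (n - i)%N%:Z) =
  gsum qs + 2 - n%:Z.
have -> : gsum qs = gsum (take i qs) + gsum (drop i qs).
  by rewrite -{1}(cat_take_drop i qs) /gsum big_cat.
lia.
Qed.

Let transfer_FP n qs xs : (0 < n)%N -> size xs = n -> all_hom FP qs xs ->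
  F (fsum qs) (gsum qs + 1 - n%:Z) (transfer n xs).
Proof.
elim/ltn_ind: n qs xs => n IH qs xs n0 sx H.
have [n1|n1] := leqP n 1.
  have n1' : n = 1%N by lia.
  move: sx H; rewrite n1'; case: xs => [|x [|y xs]] // _.
  case: qs => [|q [|q' qs]] //=; rewrite ?transfer1 /= => -[+ ?] //.
  by rewrite /FP /fsum /gsum !big_seq1 (_ : q.2 + 1 - 1%N%:Z = q.2) //; lia.
rewrite transferE //; apply: subspaceN => //.
rewrite (_ : gsum qs + 1 - n%:Z = gsum qs + 2 - n%:Z - 1); last by lia.
apply: hF; apply: lam_F_step => // i qs' xs' /andP[i0 ni]; exact: IH.
Qed.

Let lam_FP n qs xs : size xs = n -> all_hom FP qs xs ->
  F (fsum qs) (gsum qs + 2 - n%:Z) (lam n xs).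
Proof.
by apply: lam_F_step => i qs' xs' /andP[i0 ni]; exact: transfer_FP.
Qed.

Let filt_homogP n ps ns xs : filt_homog F n ps ns xs ->
  [/\ size xs = n, all_hom FP (zip ps ns) xs, fsum (zip ps ns) = isum ps &
      gsum (zip ps ns) = isum ns].
Proof.
move=> [sp [sn [sx H]]]; split=> //; last 2 first.
- by rewrite /fsum -(big_map fst xpredT id) -/(unzip1 _) unzip1_zip ?sp ?sn.
- by rewrite /gsum -(big_map snd xpredT id) -/(unzip2 _) unzip2_zip ?sp ?sn.
move: n ns xs sp sn sx H; elim: ps => [|p ps IH] [|n] // [|k ns] // [|x xs] //=.
move=> [sp] [sn] [sx] H; split; first exact: (H 0%N).
by apply: (IH n) => // i ni; exact: (H i.+1).
Qed.

Lemma transfer_F n ps ns xs : (0 < n)%N -> filt_homog F n ps ns xs ->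
  F (isum ps) (isum ns + 1 - n%:Z) (transfer n xs).
Proof. by move=> n0 /filt_homogP [sx H <- <-]; exact: transfer_FP. Qed.

Lemma lam_F n ps ns xs : filt_homog F n ps ns xs ->
  F (isum ps) (isum ns + 2 - n%:Z) (lam n xs).
Proof. by move=> /filt_homogP [sx H <- <-]; exact: lam_FP. Qed.

(** Exhaustiveness assigns filtration levels to homogeneous inputs, so statements about degrees
    follow from those about the filtration. *)
Let filt_lift ns xs : all_hom D ns xs ->
  exists2 qs, all_hom FP qs xs & gsum qs = isum ns.
Proof.
elim: ns xs => [|n ns IH] [|x xs] //=.
  by exists [::] => //; rewrite /gsum /isum !big_nil.
move=> [/(filt_exh FF) [p Fx] /IH [qs Hqs E]]; exists ((p, n) :: qs) => //.
by rewrite isum_cons -E /gsum big_cons.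
Qed.

Lemma transfer_D n ns xs : (0 < n)%N -> size xs = n -> all_hom D ns xs ->
  D (isum ns + 1 - n%:Z) (transfer n xs).
Proof.
move=> n0 sx /filt_lift [qs H <-]; apply: (filt_deg FF); exact: transfer_FP.
Qed.

Lemma lam_D n ns xs : size xs = n -> all_hom D ns xs ->
  D (isum ns + 2 - n%:Z) (lam n xs).
Proof.
move=> sx /filt_lift [qs H <-]; apply: (filt_deg FF); exact: lam_FP.
Qed.

Lemma harm_D n x : D n x -> D n (harm x).
Proof.
by move=> /(filt_exh FF) [p Fx]; apply: (filt_deg FF); exact: harm_F Fx.
Qed.

(** The sign of the composition (i, n - i) in the morphism equation: [usign] gives i - 1, and
    [esign] moves f_(n-i), of degree 1 - (n - i), past the first i inputs. *)
Definition lam_sign n ns i : K := sgn K (i.-1%:Z + (1 - (n - i)%N%:Z) * dsum ns i).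

(** The left factor has degree [dsum ns i] + 1 - i, so [eps] contributes (n - i - 1)([dsum ns i] + 1
    - i); together with (i - 1)(n - i) this is the exponent of [lam_sign] modulo 2. *)
Lemma lam_homog n ns xs : size xs = n -> all_hom D ns xs ->
  lam n xs = \sum_(1 <= i < n) lam_sign n ns i *:
    mu (transfer i (take i xs)) (transfer (n - i) (drop i xs)).
Proof.
move=> sx H; rewrite /lam /quad; apply: eq_big_nat => i /andP[i1 i2].
have si : size (take i xs) = i by rewrite size_takel // sx ltnW.
rewrite (iter_eps _ (transfer_D i1 si (all_hom_take i H))).
rewrite (lin_funZ (muLl _)) scalerA -sgn_nat -sgnD /lam_sign -/(dsum ns i).
congr (_ *: _).
apply: (@sgn_congr _ _ _ (((n - i).-1)%:Z * dsum ns i)).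
rewrite -/(dsum ns i); move: (dsum ns i) => X.
have [b ->] : exists b, (n - i = b.+1)%N by exists (n - i).-1; lia.
case: i i1 {i2 si} => // a _; rewrite /= PoszM.
have -> : a.+1%:Z = a%:Z + 1 by lia.
have -> : b.+1%:Z = b%:Z + 1 by lia.
ring.
Qed.


(** The homogeneous elements of the retract, seen inside [V]. *)
Let P n x := D n x /\ harm x = x.

Let P_D ns xs : all_hom P ns xs -> all_hom D ns xs.
Proof. by apply: all_hom_imply => k x []. Qed.

Let d_D n x : D n x -> D (n + 1) (d x).
Proof.
by move=> /(filt_exh FF) [p Fx]; apply: (filt_deg FF); exact: dF Fx.
Qed.

Lemma minop_homog n ns xs : (0 < n)%N -> size xs = n -> all_hom P ns xs ->
  P (isum ns + 2 - n%:Z) (minop n xs).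
Proof.
move=> n0 sx H; rewrite /minop; case: eqP => [n1|_].
  move: sx H; rewrite n1; case: xs => [|x [|y xs]] // _.
  case: ns => [|k [|l ns]] //= => -[[Dx hx] ?] //.
  split; last by rewrite harm_d hx.
  by rewrite isum_cons /isum big_nil (_ : _ - _ = k + 1); [exact: d_D|lia].
split; last exact: harm_idem.
by apply: harm_D; apply: lam_D => //; exact: P_D.
Qed.

Let insert_xs xs r s := take r xs ++ minop s (take s (drop r xs)) :: drop (r + s) xs.
Let insert_ns (ns : seq int) r s :=
  take r ns ++ (isum (take s (drop r ns)) + 2 - s%:Z) :: drop (r + s) ns.

Let insert_hom n ns xs r s : size xs = n -> all_hom P ns xs -> (0 < s)%N ->
  (r + s <= n)%N -> all_hom P (insert_ns ns r s) (insert_xs xs r s) /\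
  size (insert_xs xs r s) = (r + 1 + (n - r - s))%N.
Proof.
move=> sx H s0 rs; split; last first.
  by rewrite size_cat /= size_takel ?size_drop sx; lia.
apply: all_hom_cat; first exact: all_hom_take.
split; last exact: all_hom_drop.
apply: minop_homog => //; last by apply: all_hom_take; exact: all_hom_drop.
by rewrite size_takel // size_drop sx; lia.
Qed.

Let take_insert (T : Type) (u v : seq T) r k z : (r <= size u)%N ->
  take (r + 1 + k) (take r u ++ z :: v) = take r u ++ z :: take k v.
Proof.
move=> ru; rewrite take_cat size_takel // ltnNge -addnA leq_addr /=.
by rewrite addKn add1n.
Qed.

Let drop_insert (T : Type) (u v : seq T) r k z : (r <= size u)%N ->
  drop (r + 1 + k) (take r u ++ z :: v) = drop k v.
Proof.
move=> ru; rewrite drop_cat size_takel // ltnNge -addnA leq_addr /=.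
by rewrite addKn add1n.
Qed.

Let take_insert_l (T : Type) (u v : seq T) i r z : (i + r <= size u)%N ->
  take i (take (i + r) u ++ z :: v) = take i u.
Proof.
move=> ru; rewrite takel_cat ?size_takel ?leq_addr //.
by rewrite take_takel // leq_addr.
Qed.

Let drop_insert_l (T : Type) (u v : seq T) i r z : (i + r <= size u)%N ->
  drop i (take (i + r) u ++ z :: v) = take r (drop i u) ++ z :: v.
Proof.
move=> ru; rewrite drop_cat size_takel // take_drop [(r + i)%N]addnC.
case: ltnP => // ri; rewrite (_ : (i - (i + r) = 0)%N); last by lia.
rewrite drop0 [drop i _]drop_oversize // size_takel //.
Qed.

(** Insertion into the left factor: the cut after r + 1 + k letters of the shortened word is the cut
    after r + s + k letters of the original one. *)
Let left_term n ns xs r s k : size xs = n -> all_hom P ns xs -> (0 < s)%N ->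
  (r + s + k < n)%N ->
  sgn K ((r + s * (n - r - s))%N%:Z + s%:Z * dsum ns r) *:
   (lam_sign (r + 1 + (n - r - s)) (insert_ns ns r s) (r + 1 + k) *:
     mu (transfer (r + 1 + k) (take (r + 1 + k) (insert_xs xs r s)))
        (transfer (r + 1 + (n - r - s) - (r + 1 + k)) (drop (r + 1 + k) (insert_xs xs r s))))
  = - (lam_sign n ns (r + s + k) *:
     mu (stasheff_term minop transfer (r + s + k) (take (r + s + k) ns)
           (take (r + s + k) xs) r s)
        (transfer (n - (r + s + k)) (drop (r + s + k) xs))).
Proof.
move=> sx H s0 rskn; have sn := all_hom_size H.
have rx : (r <= size xs)%N by rewrite sx; lia.
have rn : (r <= size ns)%N by rewrite sn sx; lia.
rewrite /insert_xs take_insert // drop_insert // drop_drop.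
rewrite [(k + (r + s))%N]addnC.
have -> : (r + 1 + (n - r - s) - (r + 1 + k) = n - (r + s + k))%N by lia.
rewrite /stasheff_term.
have -> : (r + s + k - r - s = k)%N by lia.
rewrite (lin_funZ (muLl _)) !scalerA -scaleNr.
have tt (T : Type) (u : seq T) : take r (take (r + s + k) u) = take r u.
  by rewrite take_takel // -addnA leq_addr.
have td (T : Type) (u : seq T) : take s (drop r (take (r + s + k) u)) = take s (drop r u).
  by rewrite !take_drop take_takel // [(s + r)%N]addnC leq_addr.
have dt (T : Type) (u : seq T) : drop (r + s) (take (r + s + k) u) = take k (drop (r + s) u).
  by rewrite take_drop [(k + _)%N]addnC.
rewrite tt td dt; congr (_ *: _).
have dT : dsum (take (r + s + k) ns) r = dsum ns r by rewrite /dsum tt.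
have dI : dsum (insert_ns ns r s) (r + 1 + k) = dsum ns r +
    (isum (take s (drop r ns)) + 2 - s%:Z + isum (take k (drop (r + s) ns))).
  by rewrite /dsum take_insert // isum_cat isum_cons.
rewrite /lam_sign dI dT !dsumD.
move: (dsum ns r) (isum (take s (drop r ns))) (isum (take k (drop (r + s) ns))) => X Y U.
have [j jE] : exists j, (n = r + s + k + j)%N by exists (n - (r + s + k))%N; lia.
have -> : (n - r - s = k + j)%N by lia.
have -> : (n - (r + s + k) = j)%N by lia.
have -> : (r + 1 + (k + j) - (r + 1 + k) = j)%N by lia.
rewrite -!sgnD.
apply: (@sgn_opp _ _ _ (s%:Z * j%:Z - s%:Z - j%:Z + 1)).
have -> : ((r + 1 + k).-1 = r + k)%N by lia.
have -> : ((r + s + k).-1%:Z = r%:Z + s%:Z + k%:Z - 1) by lia.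
rewrite !(PoszD, PoszM); ring.
Qed.

(** Insertion into the right factor. The additional sign, given by the degree [dsum ns i] + 1 - i of
    the left factor, is the one occurring in the Leibniz rule. *)
Let right_term n ns xs i r s : size xs = n -> all_hom P ns xs -> (0 < i)%N ->
  (0 < s)%N -> (i + r + s <= n)%N ->
  sgn K ((i + r + s * (n - (i + r) - s))%N%:Z + s%:Z * dsum ns (i + r)) *:
   (lam_sign (i + r + 1 + (n - (i + r) - s)) (insert_ns ns (i + r) s) i *:
     mu (transfer i (take i (insert_xs xs (i + r) s)))
        (transfer (i + r + 1 + (n - (i + r) - s) - i) (drop i (insert_xs xs (i + r) s))))
  = - ((lam_sign n ns i * sgn K (dsum ns i + 1 - i%:Z)) *:
     mu (transfer i (take i xs))
        (stasheff_term minop transfer (n - i) (drop i ns) (drop i xs) r s)).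
Proof.
move=> sx H i0 s0 irsn; have sn := all_hom_size H.
have rx : (i + r <= size xs)%N by rewrite sx; lia.
have rn : (i + r <= size ns)%N by rewrite sn sx; lia.
rewrite /insert_xs take_insert_l // drop_insert_l // /stasheff_term.
rewrite !drop_drop [(r + i)%N]addnC -[(r + s + i)%N]addnA [(s + i)%N]addnC.
rewrite [(r + (i + s))%N]addnCA addnA.
have -> : (i + r + 1 + (n - (i + r) - s) - i = r + 1 + (n - (i + r) - s))%N by lia.
have -> : (n - i - r - s = n - (i + r) - s)%N by lia.
rewrite (lin_funZ (muLr _)) !scalerA -scaleNr; congr (_ *: _).
have dI : dsum (insert_ns ns (i + r) s) i = dsum ns i by rewrite /dsum take_insert_l.
rewrite /lam_sign dI dsumD [dsum (drop i ns) r]/dsum.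
move: (dsum ns i) (isum (take r (drop i ns))) => X Y.
have [t tE] : exists t, (n = i + r + s + t)%N by exists (n - (i + r + s))%N; lia.
have -> : (n - (i + r) - s = t)%N by lia.
have -> : (n - i = r + s + t)%N by lia.
have -> : (i + r + 1 + t - i = r + 1 + t)%N by lia.
rewrite -!sgnD.
apply: (@sgn_opp _ _ _ (i%:Z - 1 + s%:Z * X - X)).
have -> : (i.-1%:Z = i%:Z - 1) by lia.
rewrite !(PoszD, PoszM); ring.
Qed.

(** Both sums run over the compositions (a, i - a, n - i) of n into three parts, bracketed to the
    left and to the right; associativity identifies the products, and the signs are opposite. *)
Let assoc_sum n ns xs : size xs = n -> all_hom P ns xs ->
  \sum_(1 <= i < n) lam_sign n ns i *:
     mu (lam i (take i xs)) (transfer (n - i) (drop i xs)) +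
  \sum_(1 <= i < n) (lam_sign n ns i * sgn K (dsum ns i + 1 - i%:Z)) *:
     mu (transfer i (take i xs)) (lam (n - i) (drop i xs)) = 0.
Proof.
move=> sx H; have HD := P_D H.
pose E a i := (lam_sign n ns i * lam_sign i (take i ns) a) *:
  mu (transfer a (take a xs))
    (mu (transfer (i - a) (drop a (take i xs))) (transfer (n - i) (drop i xs))).
have -> : \sum_(1 <= i < n) lam_sign n ns i *:
     mu (lam i (take i xs)) (transfer (n - i) (drop i xs)) =
     \sum_(1 <= i < n) \sum_(1 <= a < n | (a < i)%N) E a i.
  apply: eq_big_nat => i /andP[i1 i2].
  have si : size (take i xs) = i by rewrite size_takel // sx ltnW.
  rewrite (lam_homog si (all_hom_take i HD)) (lin_fun_sum (muLl _)) scaler_sumr.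
  rewrite (big_nat_widen _ _ n) //; last exact: ltnW.
  rewrite big_nat_cond [RHS]big_nat_cond; apply: eq_bigr => a /andP[_ ai].
  by rewrite (lin_funZ (muLl _)) scalerA muA take_takel // ltnW.
have -> : \sum_(1 <= a < n) (lam_sign n ns a * sgn K (dsum ns a + 1 - a%:Z)) *:
     mu (transfer a (take a xs)) (lam (n - a) (drop a xs)) =
     \sum_(1 <= a < n) \sum_(1 <= i < n | (a < i)%N) - E a i.
  apply: eq_big_nat => a /andP[a1 a2].
  have sa : size (drop a xs) = (n - a)%N by rewrite size_drop sx.
  rewrite (lam_homog sa (all_hom_drop a HD)) (lin_fun_sum (muLr _)) scaler_sumr.
  rewrite (@sum_nat_ge _ a.+1) // -[a.+1]add1n.
  rewrite big_addn; apply: eq_big_nat => b /andP[b1 b2].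
  rewrite (lin_funZ (muLr _)) scalerA /E -scaleNr addnK subnDA drop_drop take_drop.
  rewrite [(n - b - a)%N]subnAC.
  congr (_ *: _); rewrite /lam_sign [dsum (take _ _) a]/dsum take_takel ?leq_addl //.
  rewrite -/(dsum ns a) [(b + a)%N]addnC dsumD [dsum (drop a ns) b]/dsum.
  move: (dsum ns a) (isum (take b (drop a ns))) => X Y.
  have [c cE] : exists c, (n = a + b + c)%N by exists (n - (a + b))%N; lia.
  have -> : (n - a - b = c)%N by lia.
  have -> : (n - a = b + c)%N by lia.
  have -> : (n - (a + b) = c)%N by lia.
  rewrite addKn -!sgnD; apply: (@sgn_opp _ _ _ (- a%:Z)).
  have -> : ((a + b).-1%:Z = a%:Z + b%:Z - 1) by lia.
  have -> : (a.-1%:Z = a%:Z - 1) by lia.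
  have -> : (b.-1%:Z = b%:Z - 1) by lia.
  rewrite !PoszD; ring.
rewrite (exchange_big_dep_nat xpredT) //= -big_split big1_seq // => a _ /=.
by rewrite sumrN subrr.
Qed.


(** Stasheff insertion acts on the product like a derivation: for each cut of the shortened word the
    inserted letter lies in exactly one of the two factors. *)
Let stasheff_lam n ns xs : size xs = n -> all_hom P ns xs ->
  stasheff minop lam n ns xs =
  - \sum_(1 <= i < n) lam_sign n ns i *:
      mu (stasheff minop transfer i (take i ns) (take i xs))
         (transfer (n - i) (drop i xs))
  - \sum_(1 <= i < n) (lam_sign n ns i * sgn K (dsum ns i + 1 - i%:Z)) *:
      mu (transfer i (take i xs))
         (stasheff minop transfer (n - i) (drop i ns) (drop i xs)).
Proof.
move=> sx H.
pose L i r s := lam_sign n ns i *: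
   mu (stasheff_term minop transfer i (take i ns) (take i xs) r s)
      (transfer (n - i) (drop i xs)).
pose M i r s := (lam_sign n ns i * sgn K (dsum ns i + 1 - i%:Z)) *:
   mu (transfer i (take i xs))
      (stasheff_term minop transfer (n - i) (drop i ns) (drop i xs) (r - i) s).
have -> : stasheff minop lam n ns xs =
    \sum_(0 <= r < n.+1) \sum_(0 <= s < n.+1 | (0 < s)%N && (r + s <= n)%N)
      (- (\sum_(r + s <= i < n) L i r s) - \sum_(1 <= i < r.+1) M i r s).
  apply: eq_bigr => r _; apply: eq_bigr => s /andP[s0 rs].
  have [Hi si] := insert_hom sx H s0 rs.
  rewrite /stasheff_term -/(insert_xs xs r s) (lam_homog si (P_D Hi)) scaler_sumr.
  (* The inserted letter is number r + 1, so cuts up to r leave it in the right factor and later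
     cuts in the left one. *)
  rewrite (@big_cat_nat _ _ _ r.+1) /=; [|by []|lia].
  rewrite addrC -!sumrN; congr (_ + _); last first.
    apply: eq_big_nat => i /andP[i1 i2].
    have [r' rE] : exists r', (r = i + r')%N by exists (r - i)%N; lia.
    by rewrite rE right_term -?rE // /M rE addKn.
  rewrite [LHS]sum_nat_shift [RHS]sum_nat_shift.
  have -> : (r + 1 + (n - r - s) - r.+1 = n - (r + s))%N by lia.
  apply: eq_big_nat => k /andP[_ kn].
  have -> : (k + r.+1 = r + 1 + k)%N by lia.
  have -> : (k + (r + s) = r + s + k)%N by lia.
  by rewrite left_term //; lia.
under eq_bigr => r _ do rewrite big_split /= !sumrN.
(* It remains to interchange sums, over r + s <= i < n for the left factor and 1 <= i <= r for the
   right one. *)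
rewrite big_split /= !sumrN; congr (- _ - _).
  rewrite [RHS](eq_big_nat _ _ (F2 := fun i => \sum_(0 <= r < n.+1)
     \sum_(0 <= s < n.+1 | (0 < s)%N && (r + s <= i)%N) L i r s)); last first.
    move=> i /andP[i1 i2]; rewrite (@stasheff_widen _ _ _ _ _ n); last exact: ltnW.
    rewrite (lin_fun_sum (muLl _)) scaler_sumr; apply: eq_bigr => r _.
    by rewrite (lin_fun_sum (muLl _)) scaler_sumr.
  rewrite exchange_big_nat /=; apply: eq_bigr => r _.
  rewrite (exchange_big_dep_nat (fun s => (0 < s)%N && (r + s <= n)%N)) /=; last first.
    by move=> i s /andP[i1 i2] _ _ /andP[s0 rs]; lia.
  apply: eq_bigr => s /andP[s0 rs].
  rewrite (big_nat_widenl _ 1); last by lia.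
  by apply: eq_bigl => i; rewrite s0.
rewrite [RHS](eq_big_nat _ _ (F2 := fun i => \sum_(0 <= r < n.+1 | (i <= r)%N)
     \sum_(0 <= s < n.+1 | (0 < s)%N && (r + s <= n)%N) M i r s)); last first.
  move=> i /andP[i1 i2].
  rewrite /stasheff (lin_fun_sum (muLr _)) scaler_sumr.
  have -> : (n - i).+1 = (n.+1 - i)%N by lia.
  rewrite [RHS]sum_nat_ge // [RHS]sum_nat_shift.
  apply: eq_bigr => r _; rewrite (lin_fun_sum (muLr _)) scaler_sumr.
  rewrite (big_nat_widen _ _ n.+1); last by lia.
  rewrite /M addnK; apply: eq_bigl => s; lia.
rewrite [RHS](exchange_big_dep_nat xpredT) //=; apply: eq_bigr => r _.
rewrite [RHS](exchange_big_dep_nat (fun s => (0 < s)%N && (r + s <= n)%N)) //=.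
apply: eq_bigr => s /andP[s0 rs].
rewrite (big_nat_widen _ _ n); last by lia.
by apply: eq_bigl => i; rewrite s0 rs ltnS; case: (i <= r)%N.
Qed.

Let d_lam n ns xs :
  (forall i ns xs, (0 < i < n)%N -> size xs = i -> all_hom P ns xs ->
     stasheff minop transfer i ns xs = d (transfer i xs) + lam i xs) ->
  size xs = n -> all_hom P ns xs ->
  stasheff minop lam n ns xs = - d (lam n xs).
Proof.
move=> IH sx H; rewrite stasheff_lam // -opprD; congr (- _).
rewrite (lam_homog sx (P_D H)) (lin_fun_sum dL).
(* The sum in [assoc_sum] collects the [lam] parts of the lower relations. As it is zero it may be
   added here, after which the two sides agree term by term by the Leibniz rule. *)
rewrite -[RHS]addr0 -[X in _ = _ + X](assoc_sum sx H) -!big_split /=.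
apply: eq_big_nat => i /andP[i1 i2].
have si : size (take i xs) = i by rewrite size_takel // sx ltnW.
have i12 : (0 < i < n)%N by rewrite i1.
have ni : (0 < n - i < n)%N by lia.
have sd : size (drop i xs) = (n - i)%N by rewrite size_drop sx.
rewrite (IH _ _ _ i12 si (all_hom_take i H)) (IH _ _ _ ni sd (all_hom_drop i H)).
rewrite (lin_funZ dL) (dmu _ (transfer_D i1 si (all_hom_take i (P_D H)))).
rewrite (lin_funD (muLl _)) (lin_funD (muLr _)) !scalerDr scalerA.
by rewrite addrACA.
Qed.

Lemma sum_top n (E : nat -> nat -> V) : (0 < n)%N ->
  \sum_(0 <= r < n.+1) \sum_(0 <= s < n.+1 | (0 < s)%N && (r + s <= n)%N)
     (if (r + 1 + (n - r - s) == 1)%N then E r s else 0) = E 0%N n.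
Proof.
move=> n0; rewrite big_nat_recl // [X in _ + X]big1_seq => [|r _]; last first.
  by rewrite big1 // => s /andP[s0 rs]; case: eqP => //; lia.
rewrite addr0 big_mkcond big_nat_recr //= big1_seq => [|s]; last first.
  rewrite mem_index_iota => /= sn; case: ifP => // /andP[s0 _].
  by case: eqP => //; lia.
by rewrite add0r n0 add0n leqnn /= subn0 subnn.
Qed.

(** The outer operation has arity 1 only when the whole word is inserted, so [e] contributes the
    single term [e (minop n xs)], while [T] passes through the sum. *)
Let stasheff_split n ns xs (g G : nat -> seq V -> V) (e T : V -> V) : (0 < n)%N ->
  size xs = n -> lin_fun T ->
  (forall k ys, (0 < k)%N -> g k ys = (if k == 1%N then e (nth 0 ys 0) else 0) + T (G k ys)) ->
  stasheff minop g n ns xs = e (minop n xs) + T (stasheff minop G n ns xs).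
Proof.
move=> n0 sx TL gE.
pose E r s := sgn K ((r + s * (n - r - s))%N%:Z + s%:Z * dsum ns r) *:
  e (nth 0 (take r xs ++ minop s (take s (drop r xs)) :: drop (r + s) xs) 0).
have E0 : E 0%N n = e (minop n xs).
  rewrite /E take0 drop0 /= take_oversize ?sx // subn0 subnn muln0 add0n.
  by rewrite /dsum take0 /isum big_nil mulr0 addr0 sgn0 scale1r.
rewrite -E0 -(sum_top E n0) (lin_fun_sum TL) -big_split /=.
apply: eq_bigr => r _; rewrite (lin_fun_sum TL) -big_split /=.
apply: eq_bigr => s _; rewrite /stasheff_term (lin_funZ TL) gE; last by lia.
by rewrite scalerDr; case: eqP => //; rewrite scaler0.
Qed.

Lemma transfer_rel n ns xs : (0 < n)%N -> size xs = n -> all_hom P ns xs ->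
  stasheff minop transfer n ns xs = d (transfer n xs) + lam n xs.
Proof.
elim/ltn_ind: n ns xs => n IH ns xs n0 sx H.
rewrite (@stasheff_split _ _ _ _ lam id (fun x => - h x)) //; last 2 first.
- by move=> a x y; rewrite hL opprD scalerN.
- exact: transferE1.
rewrite (d_lam _ sx H); last by move=> i ns' xs' /andP[i0 ni]; exact: IH.
rewrite (lin_funN hL) opprK transferE1 // /minop; case: eqP => [->|_].
  by rewrite lam1 (lin_fun0 dL) (lin_fun0 hL) subr0 !addr0.
(* In arity above 1 the claim reads harm lam + h d lam = lam - d h lam, and - d h lam is d f_n. *)
by rewrite /harm subrK sub0r (lin_funN dL) addrC.
Qed.

Lemma minop_rel n ns xs : (0 < n)%N -> size xs = n -> all_hom P ns xs ->
  stasheff minop minop n ns xs = 0.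
Proof.
move=> n0 sx H.
rewrite (@stasheff_split _ _ _ _ lam d harm) //; [|exact: harm_lin|by move=> *; exact: minopE].
rewrite (d_lam _ sx H); last by move=> i ns' xs' /andP[i0 _]; exact: transfer_rel.
rewrite (lin_funN harm_lin) harm_d /minop; case: eqP => [->|_]; last exact: subrr.
by rewrite lam1 (lin_fun0 harm_lin) (lin_fun0 dL) dd subr0.
Qed.

End Transfer.

(** * The morphism equation with a dg-algebra as target *)

Section DgaTarget.
Variables (K : fieldType) (V W : lmodType K) (d : V -> V) (mu : V -> V -> V).

Let sum_tuple1 n (E : seq nat -> V) : (0 < n)%N ->
  \sum_(c : 1.-tuple 'I_n.+1 |
     all (fun i => 0 < i)%N (map val c) && (sumn (map val c) == n)) E (map val c) =
  E [:: n].
Proof.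
move=> n0; rewrite (big_pred1 [tuple ord_max]) //= => c.
case/tupleP: c => x t; rewrite tuple0 /= -[RHS]val_eqE /= eqseq_cons eqxx !andbT addn0 -[x == _]val_eqE /=.
by case: eqP => [->|]; rewrite ?andbF ?n0.
Qed.

Let sum_tuple2 n (E : seq nat -> V) :
  \sum_(c : 2.-tuple 'I_n.+1 |
     all (fun i => 0 < i)%N (map val c) && (sumn (map val c) == n)) E (map val c) =
  \sum_(1 <= i < n) E [:: i; (n - i)%N].
Proof.
(* A composition of [n] into two parts is determined by its first part. *)
rewrite (reindex_onto (fun i : 'I_n.+1 => [tuple i; inord (n - i)])
  (fun c => tnth c ord0)) /=; last first.
  move=> c; case/tupleP: c => x t; case/tupleP: t => y t; rewrite tuple0 /= => /andP[_ /eqP xy].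
  apply: val_inj => /=; congr [:: _; _]; apply: val_inj => /=.
  have e : (n - x = y)%N by lia.
  by rewrite [tnth _ _]/= inordK e.
pose G i := E [:: i; (n - i)%N].
rewrite (eq_bigr (fun i : 'I_n.+1 => G i)) => [|i _]; last first.
  by rewrite inordK // ltnS leq_subr.
rewrite (eq_bigl (fun i : 'I_n.+1 => (0 < i)%N && (i < n)%N)) => [|i]; last first.
  rewrite inordK ?ltnS ?leq_subr // [tnth _ _]/= [i == i]eqxx !andbT addn0 subn_gt0.
  by rewrite subnKC ?eqxx ?andbT // -ltnS.
rewrite -(big_mkord (fun i => (0 < i)%N && (i < n)%N) G).
rewrite -(@sum_nat_ge _ 1 0) // [RHS](big_nat_widen _ _ n.+1) //.
Qed.

(** A dg-algebra has no operations of arity 3 or more, so only compositions into one or two parts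
    survive. For f = [transfer] the remaining sum is [lam n]. *)
Lemma dga_morph_rhs (f : nat -> seq W -> V) n ns xs : (0 < n)%N -> size xs = n ->
  \sum_(k < n.+1 | (0 < k)%N)
    \sum_(c : k.-tuple 'I_n.+1 |
            all (fun i => 0 < i)%N (map val c) && (sumn (map val c) == n))
      sgn K ((usign (map val c))%:Z + esign (map val c) ns) *:
        dga_ops d mu k (fblocks f (map val c) xs) =
  d (f n xs) + \sum_(1 <= i < n) lam_sign K n ns i *:
    mu (f i (take i xs)) (f (n - i)%N (drop i xs)).
Proof.
move=> n0 sx.
pose E k (c : seq nat) := sgn K ((usign c)%:Z + esign c ns) *:
  dga_ops d mu k (fblocks f c xs).
pose G k := \sum_(c : k.-tuple 'I_n.+1 |
  all (fun i => 0 < i)%N (map val c) && (sumn (map val c) == n)) E k (map val c).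
rewrite -(big_mkord (fun k => (0 < k)%N) G).
have d0 : dsum ns 0 = 0 by rewrite /dsum take0 /isum big_nil.
have G1 : G 1%N = d (f n xs).
  rewrite /G sum_tuple1 // /E /usign /esign !big_ord1 /= /psum take0 /= d0 mulr0 mul0n.
  by rewrite addr0 sgn0 scale1r drop0 take_oversize // sx.
have G2 : G 2%N = \sum_(1 <= i < n) lam_sign K n ns i *:
    mu (f i (take i xs)) (f (n - i)%N (drop i xs)).
  rewrite /G sum_tuple2; apply: eq_big_nat => i /andP[i1 i2].
  rewrite /E /usign /esign !big_ord_recl !big_ord0 /= /psum /= d0 mulr0 !addr0 add0r.
  rewrite mul1n mul0n !addn0 drop0 [take (n - i) _]take_oversize ?size_drop ?sx //.
  by rewrite /lam_sign subn1.
have G3 k : (2 < k)%N -> G k = 0.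
  by case: k => [|[|[|k]]] // _; rewrite /G big1 // => c _; rewrite /E /= scaler0.
rewrite sum_nat_ge // big_ltn // G1; congr (_ + _).
have [n1|n1] := leqP n 1; first by rewrite !big_geq.
rewrite big_ltn // G2 [X in _ + X]big1_seq ?addr0 // => k.
by rewrite mem_index_iota => /andP[_ /andP[k3 _]]; exact: G3.
Qed.

End DgaTarget.

(** * The image of an idempotent as a vector space of its own *)

Section FixedSpace.
Variables (K : fieldType) (V : lmodType K) (g : V -> V).
Hypothesis gL : lin_fun g.

(* The linearity proof is an argument so that the submodule structure below can
   be inferred from the predicate. *)
Definition fixed_by of lin_fun g : {pred V} := [pred x | g x == x].

Fact fixed_by_submod : submod_closed (fixed_by gL).
Proof.
split=> [|a x y]; rewrite !inE; first by rewrite (lin_fun0 gL).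
by move=> /eqP gx /eqP gy; rewrite gL gx gy.
Qed.

HB.instance Definition _ := GRing.isSubmodClosed.Build K V (fixed_by gL) fixed_by_submod.

Inductive fixed_space := FixedSpace x of x \in fixed_by gL.
Definition fixed_val w := let: FixedSpace x _ := w in x.

HB.instance Definition _ := [isSub for fixed_val].
HB.instance Definition _ := [Choice of fixed_space by <:].
HB.instance Definition _ := [SubChoice_isSubLmodule of fixed_space by <:].

Lemma fixed_valK (w : fixed_space) : g (fixed_val w) = fixed_val w.
Proof. by case: w => x xg; exact/eqP. Qed.

Lemma fixed_val_inj : injective fixed_val. Proof. exact: val_inj. Qed.

Lemma fixed_val_lin : lin_fun fixed_val.
Proof. by move=> a x y; rewrite -[LHS]/(\val (a *: x + y)) linearP. Qed.

Hypothesis gg : forall x, g (g x) = g x.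

Fact fixed_proj_subproof x : g x \in fixed_by gL.
Proof. by rewrite inE gg. Qed.

Definition fixed_proj x := FixedSpace (fixed_proj_subproof x).

Lemma fixed_proj_val x : fixed_val (fixed_proj x) = g x. Proof. by []. Qed.

Lemma fixed_proj_lin : lin_fun fixed_proj.
Proof.
by move=> a x y; apply: fixed_val_inj; rewrite fixed_val_lin !fixed_proj_val gL.
Qed.

End FixedSpace.

Lemma all_hom_map (I T U : Type) (P : I -> U -> Prop) (f : T -> U) ks xs :
  all_hom (fun k x => P k (f x)) ks xs -> all_hom P ks (map f xs).
Proof. by elim: ks xs => [|k ks IH] [|x xs] //= [Px /IH]. Qed.

(** * The model on the image of [harm] *)

Section Model.
Variables (K : fieldType) (V : lmodType K).
Variables (D : int -> V -> Prop) (F : int -> int -> V -> Prop).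
Variables (d : V -> V) (mu : V -> V -> V) (h eps : V -> V).
Hypotheses (FF : is_filtration D F) (Dgr : is_grading D).
Hypotheses (dL : lin_fun d) (hL : lin_fun h) (epsL : lin_fun eps) (muL : bilin mu).
Hypothesis dd : forall x, d (d x) = 0.
Hypothesis muA : forall x y z, mu (mu x y) z = mu x (mu y z).
Hypothesis dmu : forall n x y, D n x -> d (mu x y) = mu (d x) y + sgn K n *: mu x (d y).
Hypothesis dF : forall p n v, F p n v -> F p (n + 1) (d v).
Hypothesis muF : forall p q n m x y, F p n x -> F q m y -> F (p + q) (n + m) (mu x y).
Hypothesis hF : forall p n v, F p n v -> F p (n - 1) (h v).
Hypothesis hh : forall x, h (h x) = 0.
Hypothesis hdh : forall x, h (d (h x)) = h x.
Hypothesis hmin : forall p n x, F p n x -> h x = 0 -> h (d x) = 0 ->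
  F (p + 1) (n + 1) (d x).
Hypothesis epsE : forall n x, D n x -> eps x = sgn K n *: x.

Let W : lmodType K := fixed_space (harm_lin dL hL).
Let v (w : W) : V := fixed_val w.
Let proj (x : V) : W := fixed_proj (harm_lin dL hL) (harm_idem dL hL dd hh hdh) x.
Let DW n w := D n (v w).
Let FW p n w := F p n (v w).
Let dW w := proj (d (v w)).
Let nu s ws := proj (lam mu h eps s (map v ws)).
Let f s ws := transfer mu h eps s (map v ws).

Let v_lin : lin_fun v. Proof. exact: fixed_val_lin. Qed.
Let v_inj : injective v. Proof. exact: fixed_val_inj. Qed.
Let v0 : v 0 = 0. Proof. exact: lin_fun0 v_lin. Qed.
Let harm_v w : harm d h (v w) = v w. Proof. exact: fixed_valK. Qed.
Let v_proj x : v (proj x) = harm d h x. Proof. by []. Qed.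
Let proj_lin : lin_fun proj. Proof. exact: fixed_proj_lin. Qed.

Let v_dW w : v (dW w) = d (v w).
Proof. by rewrite v_proj harm_d // harm_v. Qed.

Let h_v w : h (v w) = 0. Proof. by rewrite -harm_v h_harm. Qed.

Let hd_v w : h (d (v w)) = 0.
Proof. by rewrite -harm_v -harm_d // h_harm. Qed.

Let nth_map_v ws i : nth 0 (map v ws) i = v (nth 0 ws i).
Proof.
have [wi|wi] := ltnP i (size ws); first exact: nth_map.
by rewrite !nth_default ?size_map.
Qed.

Let DW_grading : is_grading DW.
Proof.
have [D_sub [D_ind D_span]] := Dgr; split; [|split].
- move=> n; split; first by rewrite /DW v0; exact: subspace0.
  by move=> a x y Dx Dy; rewrite /DW v_lin; exact: (D_sub n).2.
- move=> s us Ds s0 z zs; apply: v_inj; rewrite v0.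
  pose s' := [seq (y.1, v y.2) | y <- s].
  apply: (D_ind s' _ _ _ (z.1, v z.2)).
  + by rewrite -map_comp.
  + by move=> _ /mapP[y ys ->] /=; exact: Ds.
  + by rewrite big_map /= -(lin_fun_sum v_lin) s0.
  + exact: (map_f (fun y => (y.1, v y.2))).
(* [harm] preserves degrees and fixes [v w], so projecting the homogeneous components of [v w]
   decomposes [w]. *)
- move=> w; have [s [Ds wE]] := D_span (v w).
  exists [seq (z.1, proj z.2) | z <- s]; split.
    move=> _ /mapP[y ys ->] /=; split=> //; rewrite /DW v_proj.
    by apply: (harm_D FF dF hF); exact: (Ds y ys).2.
  apply: v_inj; rewrite -harm_v wE big_map /= (lin_fun_sum (harm_lin dL hL)).
  by rewrite (lin_fun_sum v_lin).
Qed.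

Let FW_filtration : is_filtration DW FW.
Proof.
have [F_sub [F_deg [F_dec [F_exh F_zero]]]] := FF; do !split.
- by rewrite /FW v0; exact: subspace0.
- by move=> a x y Fx Fy; rewrite /FW v_lin; exact: (F_sub p n).2.
- by move=> p n w; exact: F_deg.
- by move=> p n w; exact: F_dec.
- by move=> n w; exact: F_exh.
- move=> n; have [p Fp] := F_zero n; exists p => w /Fp w0.
  by apply: v_inj; rewrite v0.
Qed.

Let v_ops s ws : v (ainf_ops dW nu s ws) = minop d mu h eps s (map v ws).
Proof.
rewrite /ainf_ops /minop; case: ifP => // _.
by rewrite v_dW nth_map_v.
Qed.

Let map_insert ws r s : map v (take r ws ++ ainf_ops dW nu s (take s (drop r ws)) ::
    drop (r + s) ws) =
  take r (map v ws) ++ minop d mu h eps s (take s (drop r (map v ws))) ::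
    drop (r + s) (map v ws).
Proof. by rewrite map_cat map_cons v_ops !map_take !map_drop. Qed.

Let homog_v n ns ws : homog DW n ns ws -> size (map v ws) = n /\
  all_hom (fun n x => D n x /\ harm d h x = x) ns (map v ws).
Proof.
move=> /homogP [sw H]; rewrite size_map; split=> //.
by apply: all_hom_map; apply: all_hom_imply H => k w Dw; split=> //; exact: harm_v.
Qed.

Let homog_vD n ns ws : homog DW n ns ws -> all_hom D ns (map v ws).
Proof. by move=> /homog_v [_]; apply: all_hom_imply => k x []. Qed.

Let filt_homog_v n ps ns ws : filt_homog FW n ps ns ws ->
  filt_homog F n ps ns (map v ws).
Proof.
move=> [sp [sn [sw H]]]; split=> //; split=> //; split; first by rewrite size_map.
by move=> i ni; rewrite nth_map_v; exact: H.
Qed.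

(** Relations are tested in [V]: [v] is linear and injective, and it carries the words over [W] to
    those treated by [minop_rel]. *)
Let W_ainf_rel : ainf_rel DW (ainf_ops dW nu).
Proof.
move=> n ns ws n0 /homog_v [sw H]; apply: v_inj; rewrite v0.
have := minop_rel FF Dgr dL hL muL dd muA dmu dF muF hF hh hdh epsE n0 sw H.
move=> <-; rewrite /stasheff big_mkord (lin_fun_sum v_lin); apply: eq_bigr => r _.
rewrite big_mkord (lin_fun_sum v_lin); apply: eq_bigr => s _.
by rewrite (lin_funZ v_lin) v_ops map_insert.
Qed.

Let f_morph_rel : ainf_morph_rel DW (ainf_ops dW nu) (dga_ops d mu) f.
Proof.
move=> n ns ws n0 Hws; have [sw H] := homog_v Hws.
have sw' : size ws = n by rewrite -sw size_map.
rewrite dga_morph_rhs //.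
have := transfer_rel FF Dgr dL hL muL dd muA dmu dF muF hF hh hdh epsE n0 sw H.
rewrite (lam_homog FF Dgr muL muF hF epsE sw (homog_vD Hws)) /f.
under [in X in _ -> _ = X]eq_bigr => i _ do rewrite map_take map_drop.
move=> <-; rewrite /stasheff big_mkord; apply: eq_bigr => r _.
by rewrite big_mkord; apply: eq_bigr => s _; rewrite map_insert.
Qed.

Lemma transfer_model :
  exists (W : lmodType K) (DW : int -> W -> Prop) (FW : int -> int -> W -> Prop)
         (dW : W -> W) (nu : nat -> seq W -> W) (f : nat -> seq W -> V),
    filtered_minimal_ainf DW FW dW nu /\
    filtered_ainf_morph DW FW (ainf_ops dW nu) D F (dga_ops d mu) f /\
    filtered_qiso FW dW F d (fun x => f 1%N [:: x]).
Proof.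
exists W, DW, FW, dW, nu, f.
have FdW p n w : FW p n w -> FW (p + 1) (n + 1) (dW w).
  by move=> Fw; rewrite /FW v_dW; exact: hmin.
have dWF p n w : FW p n w -> FW p (n + 1) (dW w).
  by move=> Fw; rewrite /FW v_dW; exact: dF.
split; [split|split].
- split; first exact: DW_grading.
  split; first exact: FW_filtration.
  split; first by move=> a x y; rewrite /dW v_lin dL proj_lin.
  split.
    move=> s s2; apply/multilinP => ws us a x y sE.
    rewrite /nu !map_cat !map_cons v_lin -proj_lin; congr proj.
    by apply: (multilinP _ _).1; [exact: lam_multilin|rewrite !size_map].
  split.
    move=> n w /(filt_exh FF) [p Fw]; rewrite /DW v_dW.
    by apply: (filt_deg FF); exact: dF Fw.
  split.
    move=> s ns ws s2 H; rewrite /DW v_proj; apply: (harm_D FF dF hF).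
    by apply: (lam_D FF Dgr muF hF epsE); [have [] := homog_v H|exact: homog_vD H].
  split; first exact: dWF.
  split; last exact: W_ainf_rel.
  move=> s ps ns ws s2 /filt_homog_v H; rewrite /FW v_proj.
  by apply: (harm_F FF dF hF); exact: (lam_F FF Dgr muF hF epsE).
(* The bigrading only has to split the filtration, so complements chosen in [W] serve. *)
- have [B [B_sub B_ind BE]] := filtration_split FW_filtration.
  by exists B; split=> //; split=> //; split.
- split.
    move=> s s1; apply/multilinP => ws us a x y sE.
    rewrite /f !map_cat !map_cons v_lin.
    by apply: (multilinP _ _).1; [exact: transfer_multilin|rewrite !size_map].
  split.
    move=> s ns ws s1 H.
    by apply: (transfer_D FF Dgr muF hF epsE) => //; [have [] := homog_v H|exact: homog_vD H].
  split; last exact: f_morph_rel.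
  by move=> s ps ns ws s1 /filt_homog_v H; exact: (transfer_F FF Dgr muF hF epsE).
- move=> p n; rewrite /f; split.
    (* For a cycle the term h (d a) vanishes, so a = harm a + d (h a). *)
    move=> a Fa da; exists (proj a), (h a).
    rewrite transfer1 [nth _ _ _]/=; split; [|split; [|split]].
    + by rewrite /FW v_proj; exact: (harm_F FF dF hF).
    + apply: v_inj; rewrite v_dW v_proj v0 -harm_d // da.
      exact: lin_fun0 (harm_lin dL hL).
    + exact: hF.
    + by change (a = harm d h a + d (h a)); rewrite /harm da (lin_fun0 hL) subr0 subrK.
  (* As [harm] is a chain map fixing [x], the bounding element [b] can be projected into [W] without
     leaving F^p. *)
  move=> x b Fx _ Fb; rewrite transfer1 /= => xb; exists (proj b); split.
    by rewrite /FW v_proj; exact: (harm_F FF dF hF).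
  by apply: v_inj; rewrite v_dW v_proj -harm_d // -xb harm_v.
Qed.

End Model.

Theorem theorem3p12 (K : fieldType) (V : lmodType K)
    (D : int -> V -> Prop) (F : int -> int -> V -> Prop)
    (d : V -> V) (mu : V -> V -> V) :
  filtered_dga D F d mu ->
  exists (W : lmodType K) (DW : int -> W -> Prop) (FW : int -> int -> W -> Prop)
         (dW : W -> W) (nu : nat -> seq W -> W) (f : nat -> seq W -> V),
    filtered_minimal_ainf DW FW dW nu /\
    filtered_ainf_morph DW FW (ainf_ops dW nu) D F (dga_ops d mu) f /\
    filtered_qiso FW dW F d (fun x => f 1%N [:: x]).
Proof.
move=> [Dgr [FF [dL [muL [_ [_ [dd [muA [dmu [dF muF]]]]]]]]]].
have [h [hL hF hh hdh hmin]] := filtered_contraction Dgr FF dL dd dF.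
(* The sign involution, multiplication by (-1)^n in degree n, from which [quad] draws its Koszul
   signs. *)
have [|eps [epsL epsE]] := grading_glue Dgr (g := fun n x => sgn K n *: x).
  by move=> n a x y _ _; rewrite scalerDr !scalerA mulrC.
exact: (@transfer_model K V D F d mu h eps).
Qed.
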